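(* Let $s>0$ and let $(\mathcal{X},d_{\mathcal{X}})$ be an Ahlfors $s$-regular compact metric space with a priori measure $\rho$, that is, a Borel probability measure $\rho$ supported on $\mathcal{X}$ for which there is a constant $c\ge 1$ with $c^{-1}r^s\le \rho(\overline{B}(x,r))\le c r^s$ for all $x\in\mathcal{X}$ and $0<r\le \operatorname{diam}\mathcal{X}$. Equip $\mathcal{X}^{\mathbb{N}_0}$ with the metric $d(\underline{x},\underline{y})=\sum_{n\in\mathbb{N}_0}2^{-n}d_{\mathcal{X}}(x_n,y_n)$ and let $\sigma$ be the left shift. Let $\varphi:\mathcal{X}^{\mathbb{N}_0}\to\mathbb{R}$ be a Hölder continuous function depending on the first two coordinates, and let $\mu_\varphi$ be the Gibbs measure of $\varphi$ with respect to the a priori measure $\rho$. Then $$\mathrm{mdim}_M(\mathcal{X}^{\mathbb{N}_0},\sigma,d)=\sup_{\mu\in\mathcal{M}_\sigma(\mathcal{X}^{\mathbb{N}_0})}\mathrm{rdim}(\mathcal{X}^{\mathbb{N}_0},\sigma,d,\mu)=\mathrm{rdim}(\mathcal{X}^{\mathbb{N}_0},\sigma,d,\mu_\varphi).$$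
   Context: $\mathbb{N}_0=\{0,1,2,\dots\}$; $\overline{B}(x,r)$ is the closed ball; $\sigma((x_n)_{n\ge0})=(x_{n+1})_{n\ge0}$; $\mathcal{M}_\sigma(\mathcal{X}^{\mathbb{N}_0})$ is the set of $\sigma$-invariant Borel probability measures on $\mathcal{X}^{\mathbb{N}_0}$. Depending on the first two coordinates: $\varphi(\underline{x})=\varphi(\underline{y})$ whenever $x_0=y_0$ and $x_1=y_1$; one then writes $\varphi(x_0,x_1)$. Hölder continuity is with respect to $d$. Gibbs measure: define $\mathcal{L},\overline{\mathcal{L}}:C(\mathcal{X})\to C(\mathcal{X})$ by $\mathcal{L}\psi(x_1)=\int e^{\varphi(x_0,x_1)}\psi(x_0)\,d\rho(x_0)$ and $\overline{\mathcal{L}}\psi(x_0)=\int e^{\varphi(x_0,x_1)}\psi(x_1)\,d\rho(x_1)$. It is known that $\mathcal{L}$ and $\overline{\mathcal{L}}$ have the same positive maximal eigenvalue $\lambda$, which is simple and isolated, with positive eigenfunctions. Let $\psi,\overline{\psi}>0$ be the eigenfunctions of $\mathcal{L},\overline{\mathcal{L}}$ for $\lambda$ normalized by $\int\psi\,d\rho=\int\overline{\psi}\,d\rho=1$. Put $\pi=\int\psi\overline{\psi}\,d\rho$, $\theta(x)=\psi(x)\overline{\psi}(x)/\pi$ and $K(x_0,x_1)=\dfrac{e^{\varphi(x_0,x_1)}\overline{\psi}(x_1)}{\overline{\psi}(x_0)\lambda}$. The Gibbs measure $\mu_\varphi$ is the $\sigma$-invariant Borel probability measure on $\mathcal{X}^{\mathbb{N}_0}$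 which is the law of the stationary Markov process with state space $\mathcal{X}$, initial density $\theta$ and transition density $K$ (both with respect to $\rho$), i.e. $\mu_\varphi(A_0\times\cdots\times A_n\times\mathcal{X}^{\mathbb{N}_0})=\int_{A_0\times\cdots\times A_n}\theta(x_0)K(x_0,x_1)\cdots K(x_{n-1},x_n)\,d\rho(x_0)\cdots d\rho(x_n)$ for Borel sets $A_i\subset\mathcal{X}$. Below, $T:\mathcal{Y}\to\mathcal{Y}$ is a continuous map on a compact metric space $(\mathcal{Y},d)$ and $d_N(x,y)=\max_{0\le n\le N-1}d(T^nx,T^ny)$. Mean metric dimension: let $\#(\mathcal{Y},d,\varepsilon)$ be the minimal number $n$ such that $\mathcal{Y}=\bigcup_{i=1}^nU_i$ with $\operatorname{diam}U_i<\varepsilon$ (with respect to $d$) for every $i$, and $S(\mathcal{Y},T,d,\varepsilon)=\lim_{N\to\infty}\frac1N\log\#(\mathcal{Y},d_N,\varepsilon)$. The upper and lower mean metric dimensions are $\overline{\mathrm{mdim}}_M(\mathcal{Y},T,d)=\limsup_{\varepsilon\to0}S(\mathcal{Y},T,d,\varepsilon)/|\log\varepsilon|$ and $\underline{\mathrm{mdim}}_M(\mathcal{Y},T,d)=\liminf_{\varepsilon\to0}S(\mathcal{Y},T,d,\varepsilon)/|\log\varepsilon|$; $\mathrm{mdim}_M$, without a bar, is the mean metric dimension, i.e. their common value. Mutual information: for random variables $X,Y$ on a common probability space $(\Omega,\mathbb{P})$ with values in measurable spaces, $I(X;Y)$ is the supremum of $\sum_{m,n}\mathbb{P}((X,Y)\in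 P_m\times Q_n)\log\frac{\mathbb{P}((X,Y)\in P_m\times Q_n)}{\mathbb{P}(X\in P_m)\mathbb{P}(Y\in Q_n)}$ over finite measurable partitions $\{P_m\},\{Q_n\}$ of the two target spaces (with $0\log(0/a)=0$ for all $a\ge 0$). Rate distortion dimension: let $\mu$ be a $T$-invariant Borel probability measure on $\mathcal{Y}$. For $\varepsilon>0$, $R(d,\mu,\varepsilon)$ is the infimum of $I(X;Y)/n$ over all $n\in\mathbb{N}$ and all random variables $X$ and $Y=(Y_0,\dots,Y_{n-1})$ on some common probability space such that $X$ takes values in $\mathcal{Y}$ with law $\mu$, each $Y_k$ takes values in $\mathcal{Y}$, and $\mathbb{E}\big(\frac1n\sum_{k=0}^{n-1}d(T^kX,Y_k)\big)<\varepsilon$. The upper and lower rate distortion dimensions are $\overline{\mathrm{rdim}}(\mathcal{Y},T,d,\mu)=\limsup_{\varepsilon\to0}R(d,\mu,\varepsilon)/|\log\varepsilon|$ and $\underline{\mathrm{rdim}}(\mathcal{Y},T,d,\mu)=\liminf_{\varepsilon\to0}R(d,\mu,\varepsilon)/|\log\varepsilon|$; $\mathrm{rdim}$, without a bar, is the rate distortion dimension, i.e. their common value when they agree. (Inside the supremum the result is stated with $\mathrm{rdim}$ without a bar, and it is not specified there whether the upper or the lower one is meant.) *)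

(* Defs.v *)
From HB Require Import structures.
From mathcomp Require Import all_boot all_order all_algebra.
From mathcomp Require Import finmap.
From mathcomp Require Import all_classical all_reals all_analysis.

Set Implicit Arguments.
Unset Strict Implicit.
Unset Printing Implicit Defensive.

Import Order.TTheory GRing.Theory Num.Theory.
Import numFieldNormedType.Exports.

Local Open Scope classical_set_scope.
Local Open Scope ring_scope.

(* Points are required only because MathComp-Analysis' measurable types are
   pointed; every space carrying a probability measure is nonempty anyway. *)
#[short(type="pmetricType")]
HB.structure Definition PointedMetric (K : numDomainType) :=
  { M of Metric K M & isPointed M }.

HB.mixin Record isCompactSpace M & Topological M := {
  compact_setT : compact [set: M]
}.

#[short(type="compactMetricType")]
HB.structure Definition CompactMetric (K : numDomainType) :=
  { M of PointedMetric K M & isCompactSpace M }.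

Definition borel (T : ptopologicalType) := g_sigma_algebraType (@open T).
HB.instance Definition _ (T : ptopologicalType) := Measurable.on (borel T).

(* The library's closed_ball is the closure of the open ball, which can be
   smaller than the closed ball of a general metric space. *)
Definition cball (R : realType) (X : metricType R) (x : X) (r : R) : set X :=
  [set y | mdist x y <= r].

(* The supremum over the empty set is -oo. *)
Definition diam (R : realType) (X : Type) (d : X -> X -> R) (U : set X) :
    \bar R :=
  ereal_sup [set r | exists x y, [/\ U x, U y & r = (d x y)%:E]].

Definition ahlfors_regular (R : realType) (X : pmetricType R) (s : R)
    (rho : probability (borel X) R) : Prop :=
  exists2 c : R, 1 <= c &
    forall (x : X) (r : R), 0 < r -> (r%:E <= diam (@mdist R X) setT)%E ->
      ((c^-1 * r `^ s)%:E <= rho (cball x r))%E /\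
      (rho (cball x r) <= (c * r `^ s)%:E)%E.

Section SequenceSpace.
Context (R : realType) (X : compactMetricType R).

Definition seqspace : Type := nat -> X.

HB.instance Definition _ := gen_eqMixin seqspace.
HB.instance Definition _ := gen_choiceMixin seqspace.
HB.instance Definition _ := isPointed.Build seqspace (fun=> point).

Definition seqdist_term (x y : seqspace) : R^nat :=
  fun n => 2 ^- n * mdist (x n) (y n).

Definition seqdist (x y : seqspace) : R := limn (series (seqdist_term x y)).

Lemma mdist_bounded : exists D : R, forall x y : X, mdist x y <= D.
Proof.
have := @compact_setT _ X; rewrite compact_cover => cX.
have [||D _ cov] := cX nat setT (fun n => ball (point : X) n%:R).
- move=> n _; rewrite openE => y; rewrite ballEmdist /= => py.
  rewrite /interior -nbhs_ballE.
  exists (n%:R - mdist (point : X) y) => /=; first by rewrite subr_gt0.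
  move=> z; rewrite !ballEmdist /= ltrBrDl; apply: le_lt_trans.
  exact: metric_triangle.
- move=> x _; exists (Num.truncn (mdist (point : X) x)).+1 => //.
  by rewrite ballEmdist /= truncnS_gt.
pose M := (\max_(i <- D) i)%N.
have bnd (x : X) : mdist (point : X) x <= M%:R.
  have [i iD] := cov x I; rewrite ballEmdist /= => /ltW /le_trans; apply.
  rewrite ler_nat /M; exact: leq_bigmax_seq.
exists (M%:R + M%:R) => x y.
apply: (le_trans (metric_triangle x (point : X) y)).
by rewrite lerD// metric_sym.
Qed.

Lemma seqdist_term_ge0 x y n : 0 <= seqdist_term x y n.
Proof. by rewrite mulr_ge0// ?mdist_ge0// invr_ge0 exprn_ge0. Qed.

Lemma is_cvg_seqdist x y : cvgn (series (seqdist_term x y)).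
Proof.
have [D hD] := mdist_bounded.
apply: (@series_le_cvg _ _ (geometric D (2^-1))).
- exact: seqdist_term_ge0.
- move=> n; rewrite /geometric /= mulr_ge0 ?exprn_ge0 ?invr_ge0//.
  exact: le_trans (mdist_ge0 _ _) (hD point point).
- move=> n; rewrite /seqdist_term /geometric /= mulrC exprVn.
  by rewrite ler_wpM2r ?hD// invr_ge0 exprn_ge0.
- apply: is_cvg_geometric_series.
  by rewrite ger0_norm ?invr_ge0// invf_lt1// ltr1n.
Qed.

Let seqdistxx x : seqdist x x = 0.
Proof.
rewrite /seqdist (_ : seqdist_term x x = fun=> 0).
  rewrite (_ : series _ = fun=> 0) ?lim_cst//.
  by apply/funext => n; rewrite /series /= big1.
by apply/funext => n; rewrite /seqdist_term mdistxx mulr0.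
Qed.

Lemma seqdist_term_le x y n : seqdist_term x y n <= seqdist x y.
Proof.
apply: (@le_trans _ _ (series (seqdist_term x y) n.+1)).
  rewrite /series /= big_nat_recr//= lerDr sumr_ge0// => i _.
  exact: seqdist_term_ge0.
apply: nondecreasing_cvgn_le; last exact: is_cvg_seqdist.
by apply/nondecreasing_seqP => k; rewrite /series /= big_nat_recr//= lerDl
  seqdist_term_ge0.
Qed.

Let seqdist_positivity x y : seqdist x y = 0 -> x = y.
Proof.
move=> xy0; apply/funext => n; apply: mdist_positivity.
have := seqdist_term_le x y n; rewrite xy0 => le0.
have : seqdist_term x y n == 0 by rewrite eq_le le0 seqdist_term_ge0.
by rewrite mulf_eq0 invr_eq0 expf_eq0/= pnatr_eq0 andbF => /eqP.
Qed.

Let seqdist_sym x y : seqdist x y = seqdist y x.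
Proof.
rewrite /seqdist; congr (limn (series _)).
by apply/funext => n; rewrite /seqdist_term metric_sym.
Qed.

Let seqdist_triangle y x z : seqdist x z <= seqdist x y + seqdist y z.
Proof.
rewrite /seqdist -limD; [|exact: is_cvg_seqdist..].
apply: ler_lim; first exact: is_cvg_seqdist.
  by apply: is_cvgD; exact: is_cvg_seqdist.
apply: nearW => n; rewrite /series /= fctE -big_split /=.
apply: ler_sum => i _; rewrite /seqdist_term -mulrDr ler_wpM2l ?invr_ge0 ?exprn_ge0//.
exact: metric_triangle.
Qed.

HB.instance Definition _ := @isMetric.Build R seqspace seqdist
  seqdistxx seqdist_positivity seqdist_sym seqdist_triangle.

Definition left_shift (x : seqspace) : seqspace := fun n => x n.+1.

End SequenceSpace.

Arguments left_shift {R} X.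

Section Dynamics.
Context (R : realType) (Y : pmetricType R) (T : Y -> Y).

Definition bowen_dist (N : nat) (x y : Y) : R :=
  \big[Num.max/0]_(n < N) mdist (iter n T x) (iter n T y).

(* An infimum over a set of natural numbers, hence attained; +oo if no finite
   cover exists, which cannot happen on a compact space. *)
Definition covering_number (d : Y -> Y -> R) (eps : R) : \bar R :=
  ereal_inf [set r | exists (n : nat) (U : 'I_n -> set Y),
    [/\ \bigcup_i U i = setT, forall i, (diam d (U i) < eps%:E)%E
      & r = n%:R%:E]].

Definition covering_entropy (eps : R) : \bar R :=
  limn (fun N => ((N%:R^-1 : R)%:E * lne (covering_number (bowen_dist N) eps))%E).

Definition upper_mdim : \bar R :=
  limf_esup (fun eps : R => (covering_entropy eps * (`|ln eps|^-1)%:E)%E) 0^'+.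

Definition lower_mdim : \bar R :=
  limf_einf (fun eps : R => (covering_entropy eps * (`|ln eps|^-1)%:E)%E) 0^'+.

Definition is_mdim (D : \bar R) : Prop := upper_mdim = D /\ lower_mdim = D.

Definition invariant_measure (mu : probability (borel Y) R) : Prop :=
  forall A : set (borel Y), measurable A -> mu (T @^-1` A) = mu A.

End Dynamics.

Section MutualInformation.
Context (R : realType) d d1 d2 (Omega : measurableType d)
  (T1 : measurableType d1) (T2 : measurableType d2) (P : probability Omega R).

Definition measurable_partition d' (T : measurableType d') (n : nat)
    (A : 'I_n -> set T) : Prop :=
  [/\ forall i, measurable (A i), trivIset setT A & \bigcup_i A i = setT].

(* The convention 0 * log (0 / a) = 0 is automatic, since ln is total. *)
Definition info_term (p q r : R) : R := p * ln (p / (q * r)).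

Definition mutual_information (X : {RV P >-> T1}) (Y : {RV P >-> T2}) :
    \bar R :=
  ereal_sup [set v | exists (m n : nat) (A : 'I_m -> set T1)
      (B : 'I_n -> set T2),
    [/\ measurable_partition A, measurable_partition B &
      v = (\sum_(i < m) \sum_(j < n)
             info_term (fine (P (X @^-1` A i `&` Y @^-1` B j)))
                       (fine (P (X @^-1` A i)))
                       (fine (P (Y @^-1` B j))))%:E]].

End MutualInformation.

Section RateDistortion.
Context (R : realType) (Y : pmetricType R) (T : Y -> Y)
  (mu : probability (borel Y) R).

Definition rate_distortion (eps : R) : \bar R :=
  ereal_inf [set v | exists (n : nat) (d : measure_display)
      (Omega : measurableType d) (P : probability Omega R)
      (X : {RV P >-> borel Y}) (Z : {RV P >-> n.-tuple (borel Y)}),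
    [/\ (0 < n)%N,
        forall A : set (borel Y), measurable A -> distribution P X A = mu A,
        ('E_P[(fun w => n%:R^-1 *
            \sum_(k < n) mdist (iter k T (X w) : Y) (tnth (Z w) k : Y))%R]
          < eps%:E)%E
      & v = (mutual_information X Z * (n%:R^-1 : R)%:E)%E]].

Definition upper_rdim : \bar R :=
  limf_esup (fun eps : R => (rate_distortion eps * (`|ln eps|^-1)%:E)%E) 0^'+.

Definition lower_rdim : \bar R :=
  limf_einf (fun eps : R => (rate_distortion eps * (`|ln eps|^-1)%:E)%E) 0^'+.

Definition is_rdim (D : \bar R) : Prop := upper_rdim = D /\ lower_rdim = D.

End RateDistortion.

Definition holder_continuous (R : realType) (Y : metricType R) (f : Y -> R) :
    Prop :=
  exists alpha C : R, [/\ 0 < alpha, alpha <= 1 &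
    forall x y, `|f x - f y| <= C * mdist x y `^ alpha].

Section Gibbs.
Context (R : realType) (X : compactMetricType R).

Definition depends_on_first_two (phi : seqspace X -> R) : Prop :=
  forall x y : seqspace X, x 0%N = y 0%N -> x 1%N = y 1%N -> phi x = phi y.

Definition two_coord (phi : seqspace X -> R) (a b : X) : R :=
  phi (fun n => if n is 0%N then a else b).

Context (phi : seqspace X -> R) (rho : probability (borel X) R).

Definition transfer_op (psi : X -> R) (x1 : X) : R :=
  \int[rho]_(x0 in setT) (expR (two_coord phi x0 x1) * psi x0).

Definition adjoint_transfer_op (psi : X -> R) (x0 : X) : R :=
  \int[rho]_(x1 in setT) (expR (two_coord phi x0 x1) * psi x1).

Definition eigenfunction (L : (X -> R) -> X -> R) (lam : R) (f : X -> R) :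
    Prop :=
  [/\ continuous f, exists x, f x != 0 & forall x, L f x = lam * f x].

Definition eigenvalue (L : (X -> R) -> X -> R) (lam : R) : Prop :=
  exists f, eigenfunction L lam f.

Definition maximal_eigenvalue (L : (X -> R) -> X -> R) (lam : R) : Prop :=
  eigenvalue L lam /\ forall nu, eigenvalue L nu -> nu <= lam.

Definition normalized_eigenfunction (L : (X -> R) -> X -> R) (lam : R)
    (psi : X -> R) : Prop :=
  [/\ eigenfunction L lam psi, forall x, 0 < psi x
    & \int[rho]_(x in setT) psi x = 1].

Definition initial_density (psi psib : X -> R) (x : X) : R :=
  psi x * psib x / \int[rho]_(y in setT) (psi y * psib y).

Definition transition_density (lam : R) (psib : X -> R) (x0 x1 : X) : R :=
  expR (two_coord phi x0 x1) * psib x1 / (psib x0 * lam).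

Definition path_density (theta : X -> R) (K : X -> X -> R) (l : seq X) : R :=
  if l is x0 :: l' then theta x0 * \prod_(k <- pairmap K x0 l') k else 1.

Fixpoint iterated_integral (As : seq (set X)) (f : seq X -> R) : \bar R :=
  if As is A :: As' then
    (\int[rho]_(x in A) iterated_integral As' (fun l => f (x :: l)))%E
  else (f [::])%:E.

Definition markov_law (theta : X -> R) (K : X -> X -> R)
    (mu : probability (borel (seqspace X)) R) : Prop :=
  forall (n : nat) (A : nat -> set X),
    (forall i, measurable (A i : set (borel X))) ->
    mu [set x : seqspace X | forall i, (i <= n)%N -> A i (x i)] =
    iterated_integral (mkseq A n.+1) (path_density theta K).

Definition gibbs_measure (mu : probability (borel (seqspace X)) R) : Prop :=
  exists (lam : R) (psi psib : X -> R),
    [/\ 0 < lam,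
        maximal_eigenvalue transfer_op lam /\
        maximal_eigenvalue adjoint_transfer_op lam,
        normalized_eigenfunction transfer_op lam psi /\
        normalized_eigenfunction adjoint_transfer_op lam psib,
        invariant_measure (left_shift X) mu
      & markov_law (initial_density psi psib) (transition_density lam psib) mu].

End Gibbs.

(* Main.v *)
Require Import Defs.
From HB Require Import structures.
From mathcomp Require Import all_boot all_order all_algebra.
From mathcomp Require Import all_classical all_reals all_analysis.
From mathcomp Require Import measurable_realfun ring lra.

(* The common value is the Ahlfors exponent [s] (and 0 when [X] is a single
   point). A maximal [r]-separated set of [X] has about [r ^ - s] points. Since
   the metric of the sequence space discounts late coordinates geometrically, an
   orbit segment of length [N] is determined up to [eps] by [N + O(1)]
   coordinates up to a multiple of [eps]; quantizing these bounds the covering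
   entropy, and the rate of the resulting code for an arbitrary invariant
   measure, by [s * |ln eps| + O(1)]. Separated sets give the matching lower
   bound for the covering entropy.
   For the Gibbs measure only one property is needed: [theta] and [K] are
   bounded, so the law of [n] coordinates is at most [C ^ n] times the product
   of [rho]. Testing the variational formula for mutual information on the
   product over [k < n] of ([eps ^ - s] if the [k]-th coordinates are at
   distance less than [L * eps], and 1 otherwise), whose integral is at most
   [O(1) ^ n] and whose mean logarithm is, by Markov's inequality, at least
   [n * (1 - L^-1) * s * |ln eps|], bounds the rate from below; then
   [L --> +oo]. *)

Set Implicit Arguments.
Unset Strict Implicit.
Unset Printing Implicit Defensive.

Import Order.TTheory GRing.Theory Num.Theory.
Import numFieldNormedType.Exports.

Local Open Scope classical_set_scope.
Local Open Scope ring_scope.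

(** * Limits along [0^'+] after division by [|ln e|] *)

Section LimitsAtZero.
Context {R : realType}.
Implicit Types (F : R -> \bar R) (a K : R).

Lemma limf_esup_le (T : topologicalType) (f : T -> \bar R)
    (G : set_system T) (b : \bar R) :
  (\forall x \near G, (f x <= b)%E) -> (limf_esup f G <= b)%E.
Proof.
move=> Gf; apply: ge_ereal_inf; exists (ereal_sup (f @` [set x | (f x <= b)%E])).
  by exists [set x | (f x <= b)%E].
by apply: ge_ereal_sup => _ [x + <-].
Qed.

Lemma limf_einf_ge (T : topologicalType) (f : T -> \bar R)
    (G : set_system T) (FG : Filter G) (b : \bar R) :
  (\forall x \near G, (b <= f x)%E) -> (b <= limf_einf f G)%E.
Proof.
move=> Gf; rewrite /limf_einf leeNr; apply: limf_esup_le.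
by apply: filterS Gf => x; rewrite leeN2.
Qed.

Lemma limf_einf_le_esup (T : topologicalType) (f : T -> \bar R)
    (G : set_system T) : ProperFilter G -> (limf_einf f G <= limf_esup f G)%E.
Proof.
move=> GG; rewrite limf_einfE; apply: ge_ereal_sup => _ [V GV <-].
apply: le_ereal_inf_tmp => _ [W GW <-].
have [x [Vx Wx]] := filter_ex (filterI GV GW).
apply: (@le_trans _ _ (f x)).
  by apply: ereal_inf_lbound; exists x.
by apply: ereal_sup_ubound; exists x.
Qed.

Lemma near0_abs_ln_gt (M : R) : \forall e \near (0 : R)^'+, M < `|ln e|.
Proof.
near=> e; have e0 : 0 < e by near: e; exact: nbhs_right_gt.
rewrite lter_normr; apply/orP; right; rewrite ltrNr -ltr_expR lnK//.
by near: e; apply: nbhs_right_lt; exact: expR_gt0.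
Unshelve. all: by end_near. Qed.

Lemma near0_div_abs_ln_le K e : 0 < e ->
  \forall x \near (0 : R)^'+, K * `|ln x|^-1 <= e.
Proof.
move=> e0; near=> x.
have l0 : 0 < `|ln x| by near: x; exact: near0_abs_ln_gt.
rewrite ler_pdivrMr// mulrC -ler_pdivrMr// ltW//.
by near: x; exact: near0_abs_ln_gt.
Unshelve. all: by end_near. Qed.

(** Since [|ln e|] tends to infinity as [e] decreases to 0, the additive constant [K] disappears
    after the division and only the slope [a] survives. The lower bound below is the mirror image.
    All dimension estimates are reduced to these two forms. *)
Lemma limf_esup_log_le F a K :
    (\forall e \near (0 : R)^'+, (F e <= (a * `|ln e| + K)%:E)%E) ->
  (limf_esup (fun e => F e * (`|ln e|^-1)%:E) (0 : R)^'+ <= a%:E)%E.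
Proof.
move=> hF; apply/lee_addgt0Pr => d d0; apply: limf_esup_le; near=> e.
have l0 : 0 < `|ln e| by near: e; exact: near0_abs_ln_gt.
apply: (@le_trans _ _ ((a * `|ln e| + K)%:E * (`|ln e|^-1)%:E)%E).
  apply: lee_wpmul2r; first by rewrite lee_fin invr_ge0.
  by near: e.
rewrite -EFinM lee_fin mulrDl mulfK ?gt_eqF// lerD2l.
by near: e; exact: near0_div_abs_ln_le.
Unshelve. all: by end_near. Qed.

Lemma limf_einf_log_ge F a K :
    (\forall e \near (0 : R)^'+, ((a * `|ln e| - K)%:E <= F e)%E) ->
  (a%:E <= limf_einf (fun e => F e * (`|ln e|^-1)%:E) (0 : R)^'+)%E.
Proof.
move=> hF; apply/lee_subgt0Pr => d d0; apply: limf_einf_ge; near=> e.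
have l0 : 0 < `|ln e| by near: e; exact: near0_abs_ln_gt.
apply: (@le_trans _ _ ((a * `|ln e| - K)%:E * (`|ln e|^-1)%:E)%E); last first.
  apply: lee_wpmul2r; first by rewrite lee_fin invr_ge0.
  by near: e.
rewrite -EFinM -EFinB lee_fin mulrBl mulfK ?gt_eqF// lerD2l lerN2.
by near: e; exact: near0_div_abs_ln_le.
Unshelve. all: by end_near. Qed.

End LimitsAtZero.

(* Fekete's lemma *)
Lemma subadditive_cvg (R : realType) (u : nat -> R) :
    (forall n, 0 <= u n) -> (forall m n, u (m + n)%N <= u m + u n) ->
  exists l : R, [/\ (fun n => n%:R^-1 * u n) @ \oo --> l,
    forall n, (0 < n)%N -> l <= n%:R^-1 * u n
    & forall b : R, (forall n, (0 < n)%N -> b <= n%:R^-1 * u n) -> b <= l].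
Proof.
move=> u0 uD; pose A := [set n%:R^-1 * u n | n in [set n | (0 < n)%N]].
have A_inf : has_inf A.
  split; first by exists (1%:R^-1 * u 1%N), 1%N.
  by exists 0 => _ [n /= n0 <-]; rewrite mulr_ge0// invr_ge0.
exists (inf A); split; last first.
- move=> b hb; apply: lb_le_inf; first exact: A_inf.1.
  by move=> _ [n n0 <-]; exact: hb.
- by move=> n n0; apply: ge_inf; [exact: A_inf.2|exists n].
have uM m q r : u (q * m + r)%N <= q%:R * u m + u r.
  elim: q => [|q ih]; first by rewrite mul0n add0n mul0r add0r.
  rewrite mulSn -addnA (le_trans (uD _ _))// -natr1 mulrDl mul1r.
  by have := ih; lra.
apply/cvgrPdist_le => e e0.
have e20 : 0 < e / 2 by rewrite divr_gt0.
(* Fix [m] whose average is within [e / 2] of the infimum and divide [n] by [m]: the quotient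
   contributes at most the average at [m], and the remainder at most [C], which is negligible
   against large [n]. *)
have [_ [m /= m0 <-] hm] := inf_adherent e20 A_inf.
pose C := \sum_(r < m) u r.
have uC r : (r < m)%N -> u r <= C.
  move=> rm; rewrite /C (bigD1 (Ordinal rm))//= lerDl.
  by apply: sumr_ge0 => i _; exact: u0.
near=> n.
have n0 : (0 < n)%N by near: n; exact: nbhs_infty_gt.
have nR0 : (0 : R) < n%:R by rewrite ltr0n.
have mR0 : (0 : R) < m%:R by rewrite ltr0n.
have infn : inf A <= n%:R^-1 * u n by apply: ge_inf; [exact: A_inf.2|exists n].
rewrite distrC ger0_norm ?subr_ge0//.
rewrite lerBlDl.
have un : u n <= (n %/ m)%:R * u m + C.
  by rewrite {1}(divn_eq n m) (le_trans (uM _ _ _))// lerD2l uC// ltn_mod.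
have qm : (n %/ m)%:R <= n%:R / m%:R :> R.
  by rewrite ler_pdivlMr// -natrM ler_nat leq_trunc_div.
have h1 : n%:R^-1 * u n <= m%:R^-1 * u m + n%:R^-1 * C.
  apply: (@le_trans _ _ (n%:R^-1 * (n%:R / m%:R * u m + C))).
    rewrite ler_wpM2l ?invr_ge0 ?ler0n//.
    by rewrite (le_trans un)// lerD2r ler_wpM2r.
  by rewrite mulrDr !mulrA mulVf ?gt_eqF// mul1r.
have h2 : n%:R^-1 * C <= e / 2.
  rewrite mulrC ler_pdivrMr// mulrC -ler_pdivrMr//.
  by near: n; exact: nbhs_infty_ger.
have := ltW hm; lra.
Unshelve. all: by end_near. Qed.

(** * Integrals without measurability of the integrand, and functions with finitely many values *)

Section Integration.
Context d (T : measurableType d) (R : realType).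
Implicit Types (mu : {measure set T -> \bar R}) (D : set T).

(* [rate_distortion] integrates a distance that is not known to be measurable,
   whereas the library's [ge0_le_integral] requires measurability. *)
Lemma ge0_le_integral_nonmeasurable mu D (f g : T -> \bar R) :
    (forall x, D x -> (0 <= f x)%E) -> (forall x, D x -> (f x <= g x)%E) ->
  (\int[mu]_(x in D) f x <= \int[mu]_(x in D) g x)%E.
Proof.
move=> f0 fg; have g0 x : D x -> (0 <= g x)%E.
  by move=> Dx; exact: le_trans (f0 _ Dx) (fg _ Dx).
rewrite !ge0_integralE//; apply: le_ereal_sup => _ [h hf <-]; exists h => // x.
apply: (le_trans (hf x)); rewrite /patch; case: ifPn => // xD.
by apply: fg; rewrite inE in xD.
Qed.

Lemma integral_le_cst_measure mu D (f : T -> \bar R) (C : R) :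
    measurable D -> 0 <= C ->
    (forall x, D x -> (0 <= f x)%E) -> (forall x, D x -> (f x <= C%:E)%E) ->
  (\int[mu]_(x in D) f x <= C%:E * mu D)%E.
Proof.
move=> mD C0 f0 fC; rewrite -integral_cst//.
exact: ge0_le_integral_nonmeasurable.
Qed.

(** Nothing is asked of [g]: a decoder defined on a finite set of codewords is measurable as soon as
    the encoder is. *)
Lemma measurable_finite_fibers d' (T' : measurableType d') (I : finType)
    (a : T -> I) (g : I -> T') :
    (forall i, measurable (a @^-1` [set i])) ->
  measurable_fun setT (g \o a).
Proof.
move=> ma _ B mB; rewrite setTI.
have -> : (g \o a) @^-1` B = \bigcup_(i in [set i | B (g i)]) a @^-1` [set i].
  apply/seteqP; split => [x Bx|x [i Bi /= aix]]; first by exists (a x).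
  by rewrite /preimage /= aix.
by apply: fin_bigcup_measurable => // i _; exact: ma.
Qed.

End Integration.

(** * Masses of finite disjoint families *)

Lemma measure_bigcup_fintype d (T : measurableType d) (R : realType)
    (mu : {measure set T -> \bar R}) (I : finType) (P : pred I)
    (F : I -> set T) :
    (forall i, measurable (F i)) -> trivIset setT F ->
  mu (\bigcup_(i in [set i | P i]) F i) = (\sum_(i | P i) mu (F i))%E.
Proof.
move=> mF tF; rewrite measure_fin_bigcup//; last 2 first.
- exact: finite_finset.
- exact: sub_trivIset tF.
transitivity (\sum_(i <- enum P) mu (F i))%E; last by rewrite big_enum.
have -> : [set i | P i] = [set` enum P].
  by apply/seteqP; split=> i /=; rewrite mem_enum.
by apply/esym/fsbig_seq; exact: enum_uniq.
Qed.

Lemma trivIset_preimage (T : Type) (I : eqType) (a : T -> I) :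
  trivIset setT (fun i => a @^-1` [set i]).
Proof. by move=> i j _ _ [x [/= <- <-]]. Qed.

Section FiniteProbability.
Context d (T : measurableType d) (R : realType) (P : probability T R).

Lemma fine_measure_bigcup (I : finType) (Q : pred I) (F : I -> set T) :
    (forall i, measurable (F i)) -> trivIset setT F ->
  fine (P (\bigcup_(i in [set i | Q i]) F i)) = \sum_(i | Q i) fine (P (F i)).
Proof.
move=> mF tF; rewrite measure_bigcup_fintype// sum_fine// => i _.
exact: fin_num_measure.
Qed.

Lemma fine_probability_le1 (A : set T) : measurable A -> fine (P A) <= 1.
Proof.
by move=> mA; rewrite -lee_fin fineK ?fin_num_measure// probability_le1.
Qed.

Lemma fine_probability_ge0 (A : set T) : 0 <= fine (P A).
Proof. by rewrite fine_ge0. Qed.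

Lemma le_fine_probability (A B : set T) : measurable A -> measurable B ->
  A `<=` B -> fine (P A) <= fine (P B).
Proof.
move=> mA mB AB; rewrite fine_le ?fin_num_measure//.
by apply: le_measure => //; rewrite inE.
Qed.

Lemma sum_disjoint_le1 (I : finType) (F : I -> set T) :
    (forall i, measurable (F i)) -> trivIset setT F ->
  \sum_i fine (P (F i)) <= 1.
Proof.
move=> mF tF; rewrite -fine_measure_bigcup//; apply: fine_probability_le1.
exact: fin_bigcup_measurable.
Qed.

Lemma sum_fibers (I : finType) (a : T -> I) :
    (forall i, measurable (a @^-1` [set i])) ->
  \sum_i fine (P (a @^-1` [set i])) = 1.
Proof.
move=> ma; rewrite -fine_measure_bigcup//; last exact: trivIset_preimage.
suff -> : \bigcup_(i in [set i | predT i]) a @^-1` [set i] = setT.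
  by rewrite probability_setT.
by apply/seteqP; split => // x _; exists (a x).
Qed.

End FiniteProbability.

(** * Separated sets, nets and measurable quantizers *)

Section Nets.
Context {R : realType} {X : compactMetricType R}.

Lemma cball_measurable (x : X) (r : R) : measurable (cball x r : set (borel X)).
Proof.
have oB : open (~` cball x r).
  rewrite openE => y /= /negP; rewrite -ltNge => ry.
  rewrite /interior -nbhs_ballE; exists (mdist x y - r).
    by rewrite /= subr_gt0.
  move=> z; rewrite ballEmdist /= => yz; rewrite /cball /= => xz.
  have := metric_triangle x z y; rewrite (metric_sym z y); lra.
rewrite -[cball x r]setCK; apply: measurableC.
exact: sub_sigma_algebra.
Qed.

(** Ahlfors regularity with a free cutoff [r0 > 0] in place of the diameter and with exponent 0
    allowed, so that the one-point space, whose diameter is 0, also fits. *)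
Definition ball_growth (rho : probability (borel X) R) (s c r0 : R) : Prop :=
  [/\ 0 <= s, 1 <= c, 0 < r0 & forall (x : X) (r : R), 0 < r -> r <= r0 ->
    ((c^-1 * r `^ s)%:E <= rho (cball x r))%E /\
    (rho (cball x r) <= (c * r `^ s)%:E)%E].

Variables (rho : probability (borel X) R) (s c r0 : R).
Hypothesis rho_growth : ball_growth rho s c r0.

(** The balls of radius [r / 3] around the separated points are disjoint, and their total mass is at
    most 1. *)
Lemma separated_size_le (r : R) (m : nat) (e : 'I_m -> X) :
    0 < r -> r <= r0 -> (forall i j, i != j -> r < mdist (e i) (e j)) ->
  m%:R * (c^-1 * (r / 3) `^ s) <= 1.
Proof.
move: rho_growth => [s0 c1 r00 rg] rgt rr0 esep.
have r3 : 0 < r / 3 by lra.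
have tF : trivIset setT (fun i => cball (e i) (r / 3) : set (borel X)).
  move=> i j _ _ [x [/= xi xj]]; apply/eqP/negPn/negP => /esep.
  have := metric_triangle (e i) x (e j); rewrite (metric_sym x).
  move: xi xj; rewrite /cball /=; lra.
have mF i : measurable (cball (e i) (r / 3) : set (borel X)).
  exact: cball_measurable.
rewrite mulr_natl -[m in _ *+ m]card_ord -sumr_const.
apply: le_trans (sum_disjoint_le1 rho mF tF); apply: ler_sum => i _.
rewrite -lee_fin fineK ?fin_num_measure//.
by have [//|/le_trans-> //] := rg (e i) (r / 3) r3; lra.
Qed.

(** The cells of [q] exhaust the mass 1, and each lies in a ball of radius [r]. *)
Lemma quantizer_size_ge (r : R) (m : nat) (e : 'I_m -> X) (q : X -> 'I_m) :
    0 < r -> r <= r0 -> (forall x, mdist (e (q x)) x <= r) ->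
    (forall i, measurable (q @^-1` [set i] : set (borel X))) ->
  1 <= m%:R * (c * r `^ s).
Proof.
move: rho_growth => [s0 c1 r00 rg] rgt rr0 eq mq.
rewrite mulr_natl -[m in _ *+ m]card_ord -sumr_const.
rewrite -(sum_fibers rho mq); apply: ler_sum => i _.
rewrite -lee_fin fineK ?fin_num_measure//.
have [_] := rg (e i) r rgt rr0; apply: le_trans.
apply: le_measure; rewrite ?inE//; first exact: cball_measurable.
by move=> x /= <-; exact: eq.
Qed.

(** A maximal [r]-separated family exists because ball masses bound the size of any such family. Its
    size is then squeezed between the two preceding estimates, stated here in logarithmic form. *)
Lemma exists_net (r : R) : 0 < r -> r <= r0 ->
  exists (m : nat) (e : 'I_m -> X) (q : X -> 'I_m),
    [/\ forall i j, i != j -> r < mdist (e i) (e j),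
        forall x, mdist (e (q x)) x <= r,
        forall i, measurable (q @^-1` [set i] : set (borel X)),
        - (ln c + s * ln r) <= ln m%:R
      & ln m%:R <= ln c - s * ln (r / 3)].
Proof.
move: (rho_growth) => [s0 c1 r00 rg] rgt rr0.
have c0 : 0 < c by lra.
have r3 : 0 < r / 3 by lra.
pose sep m := `[< exists e : 'I_m -> X,
  forall i j, i != j -> r < mdist (e i) (e j) >].
have sep0 : exists m, sep m by exists 0%N; apply/asboolP; exists (fun=> point); case.
have d0 : 0 < c^-1 * (r / 3) `^ s by rewrite mulr_gt0 ?invr_gt0// powR_gt0.
have sepB m : sep m -> (m <= Num.truncn ((c^-1 * (r / 3) `^ s)^-1))%N.
  move=> /asboolP[e /(separated_size_le rgt rr0) me].
  rewrite truncn_ge_nat; last by rewrite invr_ge0 ltW.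
  by rewrite -[_^-1]mul1r ler_pdivlMr.
have [m /asboolP[e esep] mmax] := ex_maxnP sep0 sepB.
(* By maximality: a point farther than [r] from the whole family could be adjoined to it, here at
   index [ord0] with the old points moved up by [lift]. *)
have cov x : exists i, mdist (e i) x <= r.
  apply/not_existsP => efar; have : sep m.+1.
    apply/asboolP; exists (fun i => oapp e x (unlift ord0 i)) => i j.
    case: (unliftP ord0 i) => [i'|] ->; case: (unliftP ord0 j) => [j'|] ->//=.
    - by rewrite (inj_eq lift_inj); exact: esep.
    - by move=> _; rewrite ltNge; apply/negP/efar.
    - by move=> _; rewrite ltNge metric_sym; apply/negP/efar.
  by move/mmax; rewrite ltnn.
have m0 : (0 < m)%N by have [[i im] _] := cov point; exact: leq_ltn_trans im.
pose near x := [pred i : 'I_m | mdist (e i) x <= r].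
pose i0 := Ordinal m0.
(* Choosing the first centre within distance [r] makes each cell a closed ball minus the earlier
   ones, hence Borel. *)
pose q x : 'I_m := nth i0 (enum 'I_m) (find (near x) (enum 'I_m)).
have hasq x : has (near x) (enum 'I_m).
  by have [i ix] := cov x; apply/hasP; exists i => //; rewrite mem_enum.
have qP x : mdist (e (q x)) x <= r by have := nth_find i0 (hasq x).
have q_lt x (i : 'I_m) : (i < q x)%N -> r < mdist (e i) x.
  move=> iq; rewrite ltNge; apply/negP => ix.
  have fm : (find (near x) (enum 'I_m) < m)%N.
    by rewrite -[ltnRHS]size_enum_ord -has_find.
  have : (i < find (near x) (enum 'I_m))%N.
    by move: iq; rewrite /q nth_enum_ord.
  by move=> /(before_find i0); rewrite nth_ord_enum /near /= ix.
have qE i : q @^-1` [set i] = cball (e i) r `&`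
    \bigcap_(j in [set j : 'I_m | (j < i)%N]) ~` cball (e j) r.
  apply/seteqP; split=> [x /= <-|x [xi xj]].
    split=> [|j /= jq]; first exact: qP.
    by apply/negP; rewrite -ltNge; exact: q_lt.
  apply/val_inj/eqP; rewrite eqn_leq leqNgt; apply/andP; split.
    by apply/negP => /q_lt; rewrite ltNge => /negP; exact.
  by rewrite leqNgt; apply/negP => /xj; apply; exact: qP.
have mq i : measurable (q @^-1` [set i] : set (borel X)).
  rewrite qE; apply: measurableI; first exact: cball_measurable.
  apply: fin_bigcap_measurable; first exact: finite_finset.
  by move=> j _; apply: measurableC; exact: cball_measurable.
exists m, e, q; split => //.
- have := quantizer_size_ge rgt rr0 qP mq.
  have mR : 0 < m%:R :> R by rewrite ltr0n.
  rewrite -ler_ln ?posrE ?mulr_gt0 ?powR_gt0// ln1 !lnM ?posrE ?mulr_gt0 ?powR_gt0//.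
  by rewrite ln_powR; lra.
- have := separated_size_le rgt rr0 esep.
  move: (r / 3) r3 => u u0.
  have mR : 0 < m%:R :> R by rewrite ltr0n.
  rewrite -ler_ln ?posrE ?mulr_gt0 ?invr_gt0 ?powR_gt0// ln1.
  rewrite !lnM ?posrE ?mulr_gt0 ?invr_gt0 ?powR_gt0//.
  by rewrite ln_powR lnV ?posrE//; lra.
Qed.

End Nets.

(** * Information between two finite partitions *)

Lemma ln_le_subr1 (R : realType) (x : R) : 0 < x -> ln x <= x - 1.
Proof. by move=> x0; have := @le_ln1Dx R (x - 1); rewrite subrKC; apply; lra. Qed.

Section FiniteInformation.
Context d (Om : measurableType d) (R : realType) (P : probability Om R).
Context (I J : finType) (a : Om -> I) (b : Om -> J).
Hypothesis ma : forall i, measurable (a @^-1` [set i]).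
Hypothesis mb : forall j, measurable (b @^-1` [set j]).

Definition joint_mass i j := fine (P (a @^-1` [set i] `&` b @^-1` [set j])).

Definition partition_information : R :=
  \sum_i \sum_j info_term (joint_mass i j)
    (fine (P (a @^-1` [set i]))) (fine (P (b @^-1` [set j]))).

Let mab i j : measurable (a @^-1` [set i] `&` b @^-1` [set j]).
Proof. exact: measurableI. Qed.

Lemma joint_mass_ge0 i j : 0 <= joint_mass i j.
Proof. exact: fine_probability_ge0. Qed.

Lemma joint_mass_lel i j : joint_mass i j <= fine (P (a @^-1` [set i])).
Proof. by apply: le_fine_probability => // x []. Qed.

Lemma joint_mass_ler i j : joint_mass i j <= fine (P (b @^-1` [set j])).
Proof. by apply: le_fine_probability => // x []. Qed.

Lemma sum_joint_mass_l j : \sum_i joint_mass i j = fine (P (b @^-1` [set j])).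
Proof.
rewrite -fine_measure_bigcup//; last first.
  by move=> i k _ _ [x [/= [<- _] [<- _]]].
by congr (fine (P _)); apply/seteqP; split=> [x [i _ []]//|x bx]; exists (a x).
Qed.

Lemma sum_joint_mass : \sum_j \sum_i joint_mass i j = 1.
Proof.
under eq_bigr do rewrite sum_joint_mass_l.
exact: sum_fibers.
Qed.

(** The information is at most the entropy of [b], and Gibbs' inequality [ln x <= x - 1] compares
    the law of [b] with the subprobability [u]. A general [u] rather than a uniform one lets several
    codewords fall into the same cell. *)
Lemma partition_information_le (K : R) (u : J -> R) :
    0 < K -> (forall j, 0 <= u j) -> \sum_j u j <= 1 ->
    (forall x, K^-1 <= u (b x)) ->
  partition_information <= ln K.
Proof.
move=> K0 u0 u1 uK.
pose q j := fine (P (b @^-1` [set j])).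
have term i j : info_term (joint_mass i j) (fine (P (a @^-1` [set i]))) (q j)
    <= joint_mass i j * ln K + joint_mass i j / q j * u j - joint_mass i j.
  have := joint_mass_ge0 i j; have := joint_mass_lel i j.
  have := joint_mass_ler i j; rewrite -/(q j) /info_term.
  move: (joint_mass i j) (fine _) => p r pq pr; rewrite le_eqVlt.
  case/predU1P => [<-|p0]; first by rewrite !mul0r addr0 subr0.
  have r0 : 0 < r by exact: lt_le_trans pr.
  have q0 : 0 < q j by exact: lt_le_trans pq.
  (* Positive mass means that the value [j] is attained, so the lower bound on [u] applies there. *)
  have Ku : K^-1 <= u j.
    have /set0P[x /= <-] : b @^-1` [set j] != set0.
      by apply/negP => /eqP bj; move: q0; rewrite /q bj measure0 ltxx.
    exact: uK.
  have x0 : 0 < p / (r * q j * K) by rewrite divr_gt0// !mulr_gt0.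
  have -> : p / (r * q j) = p / (r * q j * K) * K.
    by field; rewrite !gt_eqF.
  rewrite lnM ?posrE// mulrDr addrC -addrA lerD2l.
  have h : p / (r * q j * K) <= u j / q j.
    have -> : p / (r * q j * K) = (p / r) * (K^-1 / q j).
      by field; rewrite !gt_eqF.
    apply: (@le_trans _ _ (K^-1 / q j)).
      rewrite ler_piMl// ?ler_pdivrMr// ?mul1r//.
      by rewrite divr_ge0 ?invr_ge0 ?ltW.
    by rewrite ler_pM2r ?invr_gt0.
  have -> : p / q j * u j - p = p * (u j / q j - 1) by ring.
  rewrite ler_pM2l//; apply: le_trans (ln_le_subr1 x0) _; lra.
rewrite /partition_information exchange_big /=.
apply: le_trans (ler_sum _ (fun j _ => ler_sum _ (fun i _ => term i j))) _.
have -> : \sum_j \sum_i (joint_mass i j * ln K + joint_mass i j / q j * u j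
    - joint_mass i j) = \sum_j (\sum_i joint_mass i j) * ln K
    + \sum_j (\sum_i joint_mass i j) / q j * u j - \sum_j \sum_i joint_mass i j.
  rewrite -big_split -sumrB /=; apply: eq_bigr => j _.
  by rewrite !mulr_suml -big_split -sumrB.
rewrite -mulr_suml sum_joint_mass mul1r -addrA gerDl subr_le0.
apply: le_trans u1; apply: ler_sum => j _; rewrite sum_joint_mass_l -/(q j).
(* Where [q j] vanishes the quotient is 0 by convention, which is still at most [u j]. *)
by have [->|q0] := eqVneq (q j) 0; rewrite ?mul0r// divff// mul1r.
Qed.

(* The finite case of the Donsker-Varadhan variational formula. *)
Lemma partition_information_ge (g : I -> J -> R) (G : R) :
    0 < G -> (forall i j, 0 < g i j) ->
    \sum_j \sum_i fine (P (a @^-1` [set i])) * fine (P (b @^-1` [set j])) * g i j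
      <= G ->
  \sum_j \sum_i joint_mass i j * ln (g i j) - ln G <= partition_information.
Proof.
move=> G0 g0 gG.
pose r i j := fine (P (a @^-1` [set i])) * fine (P (b @^-1` [set j])).
(* This is [ln y <= y - 1] for [y] the ratio of the tilted product mass [r i j * g i j / G] to the
   joint mass. In the sum the joint masses add up to 1 and the tilted ones to at most 1, so the last
   two terms contribute a nonnegative amount. *)
have term i j : joint_mass i j * ln (g i j) - joint_mass i j * ln G
    + joint_mass i j - r i j * g i j / G
    <= info_term (joint_mass i j) (fine (P (a @^-1` [set i])))
         (fine (P (b @^-1` [set j]))).
  have := joint_mass_ge0 i j; have := joint_mass_lel i j.
  have := joint_mass_ler i j; rewrite /info_term /r.
  have := fine_probability_ge0 P (a @^-1` [set i]).
  have := fine_probability_ge0 P (b @^-1` [set j]).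
  move: (joint_mass i j) (fine _) (fine _) => p u v v0 u0 pv pu.
  rewrite le_eqVlt; case/predU1P => [<-|p0].
    rewrite !mul0r subrr addr0 sub0r oppr_le0 divr_ge0 ?(ltW G0)//.
    by rewrite !mulr_ge0// ltW.
  have {}u0 : 0 < u by exact: lt_le_trans pu.
  have {}v0 : 0 < v by exact: lt_le_trans pv.
  have y0 : 0 < u * v * g i j / G / p by rewrite !divr_gt0// !mulr_gt0.
  have -> : p / (u * v) = g i j / G / (u * v * g i j / G / p).
    by field; rewrite !gt_eqF ?g0.
  rewrite (@ln_div _ (g i j / G)) ?posrE ?(divr_gt0 (g0 i j) G0)//.
  rewrite (@ln_div _ (g i j)) ?posrE//.
  have := ln_le_subr1 y0; rewrite -(ler_pM2l p0).
  have -> : p * (u * v * g i j / G / p - 1) = u * v * g i j / G - p.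
    by field; rewrite !gt_eqF.
  lra.
rewrite /partition_information [leRHS]exchange_big /=.
apply: le_trans _ (ler_sum _ (fun j _ => ler_sum _ (fun i _ => term i j))).
have -> : \sum_j \sum_i (joint_mass i j * ln (g i j) - joint_mass i j * ln G
    + joint_mass i j - r i j * g i j / G)
    = \sum_j \sum_i joint_mass i j * ln (g i j)
      - (\sum_j \sum_i joint_mass i j) * ln G
      + \sum_j \sum_i joint_mass i j - (\sum_j \sum_i r i j * g i j) / G.
  rewrite !mulr_suml -sumrB -big_split -sumrB /=; apply: eq_bigr => j _.
  by rewrite !mulr_suml -sumrB -big_split -sumrB.
rewrite sum_joint_mass mul1r -addrA lerDl subr_ge0.
by rewrite ler_pdivrMr// mul1r.
Qed.

End FiniteInformation.

(** * From finite partitions to mutual information *)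

Section MutualInformationBounds.
Context d d1 d2 (Om : measurableType d) (T1 : measurableType d1)
  (T2 : measurableType d2) (R : realType) (P : probability Om R).

Lemma measurable_partition_index d' (T : measurableType d') (n : nat)
    (A : 'I_n -> set T) : measurable_partition A ->
  exists a : T -> 'I_n, A = (fun i => a @^-1` [set i]).
Proof.
move=> [_ tA cA].
have /choice[a aP] : forall x, exists i, A i x.
  by move=> x; have : (\bigcup_i A i) x by [rewrite cA]; case=> i _; exists i.
exists a; apply/funext => i; apply/seteqP; split=> [x Aix|x /= <-//].
by apply: tA => //; exists x; split => //; exact: aP.
Qed.

Lemma mutual_information_le (X : {RV P >-> T1}) (Z : {RV P >-> T2})
    (I : finType) (c : Om -> I) (g : I -> T2) :
    (0 < #|I|)%N -> (forall x, Z x = g (c x)) ->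
  (mutual_information X Z <= (ln #|I|%:R)%:E)%E.
Proof.
move=> I0 Zg; apply: ge_ereal_sup => _ [m [n [A [B [pA pB ->]]]]].
have [mA _ _] := pA; have [mB _ _] := pB.
have [a Aa] := measurable_partition_index pA.
have [b Bb] := measurable_partition_index pB.
rewrite Aa Bb in mA mB *.
have mX i : measurable ((a \o X) @^-1` [set i]).
  by have := measurable_funPTI X (mA i).
have mZ i : measurable ((b \o Z) @^-1` [set i]).
  by have := measurable_funPTI Z (mB i).
have K0 : (0 : R) < #|I|%:R by rewrite ltr0n.
(* [u j] is the share of codewords whose decoded value lies in cell [j]: the total is 1, and every
   attained cell holds at least one codeword. *)
pose u j : R := \sum_(i | b (g i) == j) #|I|%:R^-1.
rewrite lee_fin.
apply: (@partition_information_le _ _ _ _ _ _ _ _ mX mZ _ u) => //.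
- by move=> j; apply: sumr_ge0 => i _; rewrite invr_ge0.
- have -> : \sum_j u j = \sum_(i : I) (#|I|%:R^-1 : R).
    by rewrite [RHS](partition_big (fun i => b (g i)) xpredT).
  by rewrite sumr_const -[_ *+ _]mulr_natr mulVf// gt_eqF.
- move=> x; rewrite /u (bigD1 (c x))/= ?Zg ?eqxx// lerDl.
  by apply: sumr_ge0 => i _; rewrite invr_ge0.
Qed.

Lemma mutual_information_ge (X : {RV P >-> T1}) (Z : {RV P >-> T2})
    (I J : finType) (a : T1 -> I) (b : T2 -> J) :
    (forall i, measurable (a @^-1` [set i])) ->
    (forall j, measurable (b @^-1` [set j])) ->
  ((partition_information P (a \o X) (b \o Z))%:E <= mutual_information X Z)%E.
Proof.
move=> ma mb; apply: ereal_sup_ubound.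
have enum_partition d' (T : measurableType d') (K : finType) (f : T -> K) :
    (forall k, measurable (f @^-1` [set k])) ->
    measurable_partition (fun k : 'I_#|K| => f @^-1` [set enum_val k]).
  move=> mf; split=> //.
    by move=> i j _ _ [x [/= -> /enum_val_inj]].
  by apply/seteqP; split=> // x _; exists (enum_rank (f x)); rewrite //= enum_rankK.
exists #|I|, #|J|, (fun k => a @^-1` [set enum_val k]),
  (fun k => b @^-1` [set enum_val k]); split; [exact: enum_partition..|].
congr EFin; rewrite /partition_information big_enum_val/=.
by apply: eq_bigr => i _; rewrite big_enum_val.
Qed.

End MutualInformationBounds.

Definition mfun_of d1 d2 (T1 : measurableType d1) (T2 : measurableType d2)
    (f : T1 -> T2) (mf : measurable_fun setT f) : {mfun T1 >-> T2} :=
  HB.pack f (isMeasurableFun.Build _ _ _ _ f mf).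

Lemma exists_inv_mul_le (R : realType) (A d : R) : 0 < d ->
  exists n : nat, n.+1%:R^-1 * A <= d.
Proof.
move=> d0; exists (Num.truncn (A / d)).
by rewrite ler_pdivrMl ?ltr0n// -ler_pdivrMr// ltW// truncnS_gt.
Qed.

(** * Coordinates and finite blocks in the sequence space *)

Section SequenceSpaceLemmas.
Context {R : realType} {X : compactMetricType R}.
Implicit Types x y : seqspace X.

Lemma iter_left_shift k x n : iter k (left_shift X) x n = x (k + n)%N.
Proof.
elim: k n => [//|k ih] n; rewrite iterS /left_shift ih.
by rewrite addnS.
Qed.

Lemma mdist_coord_le x y n : mdist (x n) (y n) <= 2 ^+ n * mdist x y.
Proof. by have := seqdist_term_le x y n; rewrite ler_pdivrMl. Qed.

Lemma coord0_dist_le x y : mdist (x 0%N) (y 0%N) <= mdist x y.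
Proof. by have := mdist_coord_le x y 0; rewrite expr0 mul1r. Qed.

Lemma measurable_coord n :
  measurable_fun setT ((fun x => x n) : borel (seqspace X) -> borel X).
Proof.
have open_preimage (U : set X) : open U ->
    @open (seqspace X) ((fun x => x n) @^-1` U).
  rewrite !openE => oU x /= /oU; rewrite /interior -nbhs_ballE.
  move=> [e /= e0 eU]; rewrite -nbhs_ballE.
  exists (2 ^- n * e); first by rewrite /= mulr_gt0 ?invr_gt0 ?exprn_gt0.
  move=> y; rewrite ballEmdist /= => xy; apply: eU; rewrite ballEmdist /=.
  apply: le_lt_trans (mdist_coord_le x y n) _.
  by rewrite -ltr_pdivlMl ?exprn_gt0.
apply: (@measurability _ _ (borel (seqspace X)) (borel X) setT
  (fun x => x n) (@open X)) => // _ [U oU <-].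
by rewrite setTI; apply: sub_sigma_algebra; exact: open_preimage.
Qed.

(** The weights [2 ^- j] sum to 2, and those from [l] on to [2 * 2 ^- l]; the agreeing coordinates
    cost [r] each and the others at most [D]. *)
Lemma mdist_le_of_coords (D r : R) (l : nat) x y :
    0 <= r -> (forall a b : X, mdist a b <= D) ->
    (forall j, (j < l)%N -> mdist (x j) (y j) <= r) ->
  mdist x y <= 2 * r + 2 ^- l * (2 * D).
Proof.
move=> r0 hD xy.
have D0 : 0 <= D by exact: le_trans (mdist_ge0 _ _) (hD point point).
apply: limr_le; first exact: is_cvg_seqdist.
(* Induction on the partial sums: splitting off coordinate 0 leaves half of the same sum for the
   shifted sequences, with [l] lowered by one unless it is already 0. *)
apply: nearW => n; rewrite /series /=; elim: n l x y xy => [|n ih] l x y xy.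
  by rewrite big_geq// addr_ge0 ?mulr_ge0 ?invr_ge0 ?exprn_ge0.
rewrite big_nat_recl//= {1}/seqdist_term expr0 invr1 mul1r.
have -> : \sum_(0 <= i < n) seqdist_term x y i.+1 =
    2^-1 * \sum_(0 <= i < n) seqdist_term (left_shift X x) (left_shift X y) i.
  rewrite mulr_sumr; apply: eq_bigr => i _.
  by rewrite /seqdist_term exprS invfM mulrA.
case: l xy => [|l] xy.
  have := hD (x 0%N) (y 0%N); have := ih 0%N (left_shift X x) (left_shift X y).
  by rewrite expr0 => /(_ ltac:(by [])); lra.
have := xy 0%N isT.
have := ih l (left_shift X x) (left_shift X y) (fun j jl => xy j.+1 jl).
by rewrite exprS invfM; lra.
Qed.

Definition block_code (m n : nat) (q : X -> 'I_m) x : {ffun 'I_n -> 'I_m} :=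
  [ffun k : 'I_n => q (x k)].

Lemma measurable_block_code m n (q : X -> 'I_m) (w : {ffun 'I_n -> 'I_m}) :
    (forall i, measurable (q @^-1` [set i] : set (borel X))) ->
  measurable (block_code n q @^-1` [set w] : set (borel (seqspace X))).
Proof.
move=> mq.
have -> : block_code n q @^-1` [set w] =
    \bigcap_(k in [set: 'I_n]) [set x | q (x k) = w k].
  apply/seteqP; split=> [x /= <- k _ /=|x xw]; first by rewrite ffunE.
  by apply/ffunP => k; rewrite ffunE; exact: xw.
apply: fin_bigcap_measurable; first exact: finite_finset.
move=> k _; have := @measurable_coord k measurableT _ (mq (w k)).
by rewrite setTI.
Qed.

End SequenceSpaceLemmas.

(** * Upper bound for the rate of an arbitrary measure *)

Section RateDistortionUpper.
Context {R : realType} {X : compactMetricType R}.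
Variables (rho : probability (borel X) R) (s c r0 : R).
Hypothesis rho_growth : ball_growth rho s c r0.
Variable mu : probability (borel (seqspace X)) R.

Lemma exists_tail_length (D e : R) : 0 < e ->
  exists l : nat, 2 ^- l * D < e.
Proof.
move=> e0; have : (fun l => D * 2^-1 ^+ l) @ \oo --> (0 : R).
  by apply: cvg_geometric; rewrite ger0_norm ?invf_lt1// ltr1n.
move=> /cvgrPdist_lt/(_ e e0)[l _ /(_ l (leqnn l))].
rewrite /= sub0r normrN => /(le_lt_trans (ler_norm _)).
by rewrite exprVn mulrC; exists l.
Qed.

(** The source is [mu] on the sequence space itself, and the code quantizes the first [n + l]
    coordinates by [q]. It has [m ^ (n + l)] words, and [l] does not depend on [n], so the rate per
    step tends to [ln m] as [n] grows. *)
Lemma rate_distortion_le_code (eps r : R) (m : nat) (e : 'I_m -> X)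
    (q : X -> 'I_m) :
    0 < eps -> 0 <= r -> 4 * r <= eps -> (forall x, mdist (e (q x)) x <= r) ->
    (forall i, measurable (q @^-1` [set i] : set (borel X))) ->
  (rate_distortion (left_shift X) mu eps <= (ln m%:R)%:E)%E.
Proof.
move=> eps0 r_ge0 r_eps eq mq.
have m0 : (0 < m)%N by have [i im] := q point; exact: leq_ltn_trans im.
have lnm0 : 0 <= ln m%:R :> R by rewrite ln_ge0// ler1n.
have [D hD] := mdist_bounded X.
(* Half of [eps] pays for the coordinates from [l] on, the other half for the quantization error
   [2 * r]. *)
have [|l hl] := @exists_tail_length (2 * D) (eps / 2); first by lra.
apply/lee_addgt0Pr => d d0.
have [n' n_large] := exists_inv_mul_le (l%:R * ln m%:R) d0.
set n := n'.+1 in n_large.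
(* [decode k] rebuilds the orbit point at time [k], with net points in coordinates below [l] and an
   arbitrary point beyond. For [k < n] and [j < l] the index [k + j] is below [n + l], so the
   default of [oapp] is not reached. *)
pose decode (k : nat) (w : {ffun 'I_(n + l) -> 'I_m}) : seqspace X := fun j =>
  if (j < l)%N then oapp (fun i => e (w i)) point (insub (k + j)%N) else point.
pose g (w : {ffun 'I_(n + l) -> 'I_m}) : n.-tuple (borel (seqspace X)) :=
  [tuple decode k w | k < n].
have mZ := measurable_finite_fibers g (fun w => measurable_block_code w mq).
pose Z : {RV mu >-> n.-tuple (borel (seqspace X))} := mfun_of mZ.
pose X0 : {RV mu >-> borel (seqspace X)} :=
  mfun_of (@measurable_id _ (borel (seqspace X)) setT).
apply: (@le_trans _ _ (mutual_information X0 Z * (n%:R^-1)%:E)%E).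
  apply: ereal_inf_lbound.
  exists n, _, (borel (seqspace X)), mu, X0, Z; split=> //.
  apply: (@le_lt_trans _ _ (2 * r + 2 ^- l * (2 * D))%:E); last first.
    by rewrite lte_fin; lra.
  rewrite unlock -[leRHS]mule1 -[X in (_ * X)%E](probability_setT mu).
  have D0 : 0 <= D by exact: le_trans (mdist_ge0 _ _) (hD point point).
  apply: integral_le_cst_measure => //.
  - by rewrite addr_ge0 ?mulr_ge0 ?invr_ge0 ?exprn_ge0.
  - move=> x _; rewrite lee_fin mulr_ge0 ?invr_ge0// sumr_ge0// => k _.
    exact: mdist_ge0.
  move=> x _; rewrite lee_fin ler_pdivrMl ?ltr0n//.
  set C := 2 * r + _; have -> : n%:R * C = \sum_(k < n) C.
    by rewrite sumr_const card_ord mulr_natl.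
  apply: ler_sum => k _; apply: mdist_le_of_coords => // j jl.
  rewrite tnth_mktuple /decode jl iter_left_shift.
  have kj : (k + j < n + l)%N by rewrite -addnS leq_add// ltnW.
  by rewrite insubT /= ffunE metric_sym.
have := @mutual_information_le _ _ _ _ _ _ _ _ X0 Z _ (block_code (n + l) q) g.
rewrite card_ffun !card_ord expn_gt0 m0 /= => /(_ isT (fun=> erefl)) hI.
apply: le_trans (lee_wpmul2r _ hI) _; first by rewrite lee_fin invr_ge0.
rewrite -EFinM -EFinD lee_fin natrX lnXn ?ltr0n// -[_ *+ (n + l)]mulr_natl natrD.
have -> : (n%:R + l%:R) * ln m%:R * n%:R^-1 =
    ln m%:R + n%:R^-1 * (l%:R * ln m%:R) :> R by field; rewrite pnatr_eq0.
by rewrite lerD2l.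
Qed.

End RateDistortionUpper.

(** * Covering numbers of Bowen metrics and their growth rate *)

Section CoveringEntropy.
Context {R : realType} {Y : pmetricType R}.
Implicit Types (d : Y -> Y -> R) (eps : R).

Definition finite_cover d eps (n : nat) : Prop :=
  exists U : 'I_n -> set Y,
    \bigcup_i U i = setT /\ forall i, (diam d (U i) < eps%:E)%E.

Lemma finite_cover_fintype d eps (I : finType) (U : I -> set Y) :
    \bigcup_i U i = setT -> (forall i, (diam d (U i) < eps%:E)%E) ->
  finite_cover d eps #|I|.
Proof.
move=> cU dU; exists (fun k => U (enum_val k)); split; last by move=> k.
apply/seteqP; split=> // x _; have : (\bigcup_i U i) x by rewrite cU.
by case=> i _ Uix; exists (enum_rank i); rewrite //= enum_rankK.
Qed.

Lemma finite_cover_gt0 d eps n : finite_cover d eps n -> (0 < n)%N.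
Proof.
move=> [U [cU _]]; have : (\bigcup_i U i) (point : Y) by rewrite cU.
by case=> i _ _; exact: leq_ltn_trans (ltn_ord i).
Qed.

Lemma covering_numberE d eps : (exists n, finite_cover d eps n) ->
  exists n, [/\ finite_cover d eps n, covering_number d eps = n%:R%:E
    & forall k, finite_cover d eps k -> (n <= k)%N].
Proof.
move=> [k0 ck0]; have exP : exists k, `[< finite_cover d eps k >].
  by exists k0; exact/asboolP.
have [n /asboolP cn nmin] := ex_minnP exP.
have {}nmin k : finite_cover d eps k -> (n <= k)%N.
  by move=> ck; apply: nmin; exact/asboolP.
exists n; split => //; apply/eqP; rewrite eq_le; apply/andP; split.
  apply: ereal_inf_lbound; have [U [cU dU]] := cn.
  by exists n, U.
apply: le_ereal_inf_tmp => _ [k [U [cU dU ->]]].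
by rewrite lee_fin ler_nat; apply: nmin; exists U.
Qed.

Variable T : Y -> Y.

Lemma le_bowen_dist N x y k : (k < N)%N ->
  mdist (iter k T x) (iter k T y) <= bowen_dist T N x y.
Proof. by move=> kN; exact: (le_bigmax _ _ (Ordinal kN)). Qed.

Lemma bowen_distD M N x y : bowen_dist T (M + N) x y <=
  Num.max (bowen_dist T M x y) (bowen_dist T N (iter M T x) (iter M T y)).
Proof.
apply: bigmax_le => [|[k kMN] _ /=].
  by rewrite le_max bigmax_ge_id.
rewrite le_max; have [kM|Mk] := ltnP k M; first by rewrite le_bowen_dist.
apply/orP; right; rewrite -(subnK Mk) !iterD.
by apply: le_bowen_dist; rewrite ltn_subLR.
Qed.

(** Intersecting a cover for the first [M] steps with the pullback under [iter M T] of one for the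
    next [N] steps makes the logarithm of the covering number subadditive. *)
Lemma finite_coverD M N eps m n :
    finite_cover (bowen_dist T M) eps m -> finite_cover (bowen_dist T N) eps n ->
  finite_cover (bowen_dist T (M + N)) eps (m * n).
Proof.
move=> [U [cU dU]] [V [cV dV]].
have -> : (m * n)%N = #|{: 'I_m * 'I_n}| by rewrite card_prod !card_ord.
apply: (@finite_cover_fintype _ _ _
  (fun ij => U ij.1 `&` iter M T @^-1` V ij.2)).
  apply/seteqP; split=> // x _.
  have : (\bigcup_i U i) x by rewrite cU.
  have : (\bigcup_i V i) (iter M T x) by rewrite cV.
  by move=> [j _ Vj] [i _ Ui]; exists (i, j).
move=> [i j] /=; apply: (@le_lt_trans _ _
  (Order.max (diam (bowen_dist T M) (U i)) (diam (bowen_dist T N) (V j)))).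
  apply: ge_ereal_sup => _ [x [y [[Ux Vx] [Uy Vy] ->]]].
  rewrite le_max; have := bowen_distD M N x y; rewrite le_max.
  case/orP => h; apply/orP; [left|right].
    apply: (@le_trans _ _ (bowen_dist T M x y)%:E); first by rewrite lee_fin.
    by apply: ereal_sup_ubound; exists x, y.
  set x' := iter M T x in h *; set y' := iter M T y in h *.
  apply: (@le_trans _ _ (bowen_dist T N x' y')%:E); first by rewrite lee_fin.
  by apply: ereal_sup_ubound; exists x', y'.
by rewrite gt_max dU dV.
Qed.

(** By Fekete's lemma the [limn] in [covering_entropy] is a genuine limit and the infimum of the
    averages. The lower bound then passes to the infimum, while the overhead [k] is averaged out by
    taking one large [n]. *)
Lemma covering_entropy_bounds eps (m M k : nat) :
    (0 < m)%N -> (0 < M)%N ->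
    (forall N n, finite_cover (bowen_dist T N) eps n -> (m ^ N <= n)%N) ->
    (forall N, finite_cover (bowen_dist T N) eps (M ^ (N + k))) ->
  ((ln m%:R)%:E <= covering_entropy T eps)%E /\
  (covering_entropy T eps <= (ln M%:R)%:E)%E.
Proof.
move=> m0 M0 hm hM.
have /choice[a aP] : forall N, exists n, [/\ finite_cover (bowen_dist T N) eps n,
    covering_number (bowen_dist T N) eps = n%:R%:E
    & forall j, finite_cover (bowen_dist T N) eps j -> (n <= j)%N].
  by move=> N; apply: covering_numberE; exists (M ^ (N + k))%N.
have a0 N : (0 : R) < (a N)%:R.
  by rewrite ltr0n; have [/finite_cover_gt0] := aP N.
have lna0 N : 0 <= ln (a N)%:R :> R by rewrite ln_ge0// ler1n -(ltr0n R).
have lnaD i j : ln (a (i + j)%N)%:R <= ln (a i)%:R + ln (a j)%:R :> R.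
  rewrite -lnM ?posrE// ler_ln ?posrE ?mulr_gt0// -natrM ler_nat.
  have [ci _ _] := aP i; have [cj _ _] := aP j; have [_ _] := aP (i + j)%N.
  by apply; exact: finite_coverD.
have [l [cl l_le l_ge]] := subadditive_cvg lna0 lnaD.
have -> : covering_entropy T eps = l%:E.
  rewrite /covering_entropy; apply/cvg_lim => //.
  have -> : (fun N => ((N%:R^-1 : R)%:E *
      lne (covering_number (bowen_dist T N) eps))%E) =
      EFin \o (fun N => N%:R^-1 * ln (a N)%:R).
    by apply/funext => N; have [_ -> _] := aP N; rewrite lne_EFin//= -EFinM.
  by apply: cvg_EFin => //; exact: nearW.
rewrite !lee_fin; split.
  apply: l_ge => n n0; rewrite ler_pdivlMl ?ltr0n// mulr_natl -lnXn ?ltr0n//.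
  rewrite -natrX ler_ln ?posrE ?ltr0n ?expn_gt0 ?m0 -?(ltr0n R)// ler_nat.
  by apply: hm; have [] := aP n.
apply/ler_addgt0Pr => d d0.
have [n' hn] := exists_inv_mul_le (k%:R * ln M%:R) d0.
set n := n'.+1 in hn; apply: le_trans (l_le n isT) _.
apply: (@le_trans _ _ (n%:R^-1 * ((n + k)%:R * ln M%:R))).
  rewrite ler_pM2l ?invr_gt0 ?ltr0n// mulr_natl -lnXn ?ltr0n// -natrX.
  rewrite ler_ln ?posrE ?ltr0n ?expn_gt0 ?M0 -?(ltr0n R)// ler_nat.
  by have [_ _] := aP n; apply; exact: hM.
rewrite natrD mulrDl mulrDr mulrA mulVf ?pnatr_eq0// mul1r; lra.
Qed.

End CoveringEntropy.

(** * Dimension bounds for the shift *)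

Section ShiftDimensions.
Context {R : realType} {X : compactMetricType R}.
Local Notation shift := (left_shift X).

(** Pigeonhole: the [m ^ N] words over a separated set give sequences that are pairwise more than
    [eps] apart in the Bowen metric, so a set of smaller diameter contains at most one of them. *)
Lemma separated_cover_ge (eps : R) (m : nat) (e : 'I_m -> X) :
    (forall i j, i != j -> eps < mdist (e i) (e j)) ->
  forall N n, finite_cover (bowen_dist shift N) eps n -> (m ^ N <= n)%N.
Proof.
move=> esep N n [U [cU dU]].
pose p (w : {ffun 'I_N -> 'I_m}) : seqspace X :=
  fun j => oapp (fun i => e (w i)) point (insub j).
have /choice[h hP] : forall w, exists i, U i (p w).
  by move=> w; have : (\bigcup_i U i) (p w) by [rewrite cU]; case=> i _; exists i.
suff h_inj : injective h.
  by have := leq_card h h_inj; rewrite card_ffun !card_ord.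
move=> w w' hw; apply/ffunP => k; apply/eqP/negPn/negP => /esep.
apply/negP; rewrite -leNgt -lee_fin; apply/ltW.
apply: le_lt_trans (dU (h w)).
apply: (@le_trans _ _ (bowen_dist shift N (p w) (p w'))%:E).
  rewrite lee_fin; apply: le_trans (le_bowen_dist shift (p w) (p w') (ltn_ord k)).
  apply: le_trans (coord0_dist_le _ _).
  by rewrite !iter_left_shift addn0 /p valK.
apply: ereal_sup_ubound; exists (p w), (p w'); split => //.
by rewrite hw; exact: hP.
Qed.

(** The cover consists of the cells of the block code. Within a cell the first [N + l] coordinates
    differ by at most [2 * r], so the Bowen distance is at most [4 * r] plus a tail below
    [eps / 2]. *)
Lemma net_finite_cover (eps r : R) (m : nat) (e : 'I_m -> X) (q : X -> 'I_m) :
    0 < eps -> 0 <= r -> 16 * r <= eps -> (forall x, mdist (e (q x)) x <= r) ->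
  exists l, forall N, finite_cover (bowen_dist shift N) eps (m ^ (N + l)).
Proof.
move=> eps0 r_ge0 r_eps eq; have [D hD] := mdist_bounded X.
have [|l hl] := @exists_tail_length _ (2 * D) (eps / 2); first by lra.
exists l => N.
have -> : (m ^ (N + l))%N = #|{ffun 'I_(N + l) -> 'I_m}|.
  by rewrite card_ffun !card_ord.
apply: (@finite_cover_fintype _ _ _ _ _
  (fun w => block_code (N + l) q @^-1` [set w])).
  by apply/seteqP; split=> // x _; exists (block_code (N + l) q x).
move=> w; apply: (@le_lt_trans _ _ (2 * (2 * r) + 2 ^- l * (2 * D))%:E).
  apply: ge_ereal_sup => _ [x [y [/= xw yw ->]]]; rewrite lee_fin.
  have D0 : 0 <= D by exact: le_trans (mdist_ge0 _ _) (hD point point).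
  apply: bigmax_le => [|k _].
    by rewrite addr_ge0 ?mulr_ge0 ?invr_ge0 ?exprn_ge0.
  apply: mdist_le_of_coords => //; first by rewrite mulr_ge0.
  move=> j jl; rewrite !iter_left_shift.
  have kj : (k + j < N + l)%N by rewrite -addnS leq_add// ltnW.
  have := congr1 (fun f : {ffun _ -> _} => f (Ordinal kj)) (etrans xw (esym yw)).
  rewrite !ffunE /= => qxy.
  have := eq (y (k + j)%N); rewrite -qxy.
  have := eq (x (k + j)%N); rewrite metric_sym.
  have := metric_triangle (x (k + j)%N) (e (q (x (k + j)%N))) (y (k + j)%N).
  lra.
by rewrite lte_fin; lra.
Qed.

Variables (rho : probability (borel X) R) (s c r0 : R).
Hypothesis rho_growth : ball_growth rho s c r0.

Lemma abs_ln_lt1 (e : R) : 0 < e -> e < 1 -> `|ln e| = - ln e.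
Proof. by move=> e0 e1; rewrite ler0_norm// ln_le0// ltW. Qed.

Lemma shift_lower_mdim_ge : (s%:E <= lower_mdim shift)%E.
Proof.
move: (rho_growth) => [s0 c1 r00 _].
apply: (@limf_einf_log_ge _ (covering_entropy shift) s (ln c)).
near=> eps.
have eps0 : 0 < eps by near: eps; exact: nbhs_right_gt.
have eps1 : eps < 1 by near: eps; exact: nbhs_right_lt.
have epsr : eps <= r0 by near: eps; exact: nbhs_right_le.
have [m [e [q [esep _ _ lnm _]]]] := exists_net rho_growth eps0 epsr.
(* The finer net supplies the finite covers that [covering_entropy_bounds] asks for besides the
   separated set. *)
have [||M [e' [q' [_ eq' _ _ _]]]] := @exists_net _ _ _ _ _ _ rho_growth (eps / 16).
- by lra.
- by lra.
have [||l hl] := @net_finite_cover eps (eps / 16) M e' q' eps0 _ _ eq'.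
- by lra.
- by lra.
have m0 : (0 < m)%N by have [i im] := q point; exact: leq_ltn_trans im.
have M0 : (0 < M)%N by have [i im] := q' point; exact: leq_ltn_trans im.
have [+ _] := covering_entropy_bounds m0 M0 (separated_cover_ge esep) hl.
apply: le_trans; rewrite lee_fin abs_ln_lt1//; lra.
Unshelve. all: by end_near. Qed.

Lemma shift_upper_mdim_le : (upper_mdim shift <= s%:E)%E.
Proof.
move: (rho_growth) => [s0 c1 r00 _].
(* 48 is 16 times 3: the net has scale [eps / 16], and its size is estimated by balls of a third of
   that radius. *)
apply: (@limf_esup_log_le _ (covering_entropy shift) s (ln c + s * ln 48)).
near=> eps.
have eps0 : 0 < eps by near: eps; exact: nbhs_right_gt.
have eps1 : eps < 1 by near: eps; exact: nbhs_right_lt.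
have epsr : eps <= r0 by near: eps; exact: nbhs_right_le.
have [m [e [q [esep _ _ _ _]]]] := exists_net rho_growth eps0 epsr.
have [||M [e' [q' [_ eq' _ _ lnM]]]] := @exists_net _ _ _ _ _ _ rho_growth (eps / 16).
- by lra.
- by lra.
have [||l hl] := @net_finite_cover eps (eps / 16) M e' q' eps0 _ _ eq'.
- by lra.
- by lra.
have m0 : (0 < m)%N by have [i im] := q point; exact: leq_ltn_trans im.
have M0 : (0 < M)%N by have [i im] := q' point; exact: leq_ltn_trans im.
have [_ +] := covering_entropy_bounds m0 M0 (separated_cover_ge esep) hl.
move=> /le_trans; apply; rewrite lee_fin abs_ln_lt1//.
have e48 : eps / 16 / 3 = eps / 48 by field.
move: lnM; rewrite e48 ln_div ?posrE//; lra.
Unshelve. all: by end_near. Qed.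

Lemma shift_upper_rdim_le (mu : probability (borel (seqspace X)) R) :
  (upper_rdim shift mu <= s%:E)%E.
Proof.
move: (rho_growth) => [s0 c1 r00 _].
(* 12 is 4 times 3, for a net of scale [eps / 4] and balls of a third of that radius. *)
apply: (@limf_esup_log_le _ (rate_distortion shift mu) s (ln c + s * ln 12)).
near=> eps.
have eps0 : 0 < eps by near: eps; exact: nbhs_right_gt.
have eps1 : eps < 1 by near: eps; exact: nbhs_right_lt.
have epsr : eps <= r0 by near: eps; exact: nbhs_right_le.
have [||M [e [q [_ eq mq _ lnM]]]] := @exists_net _ _ _ _ _ _ rho_growth (eps / 4).
- by lra.
- by lra.
have r_ge0 : 0 <= eps / 4 by lra.
have r_le : 4 * (eps / 4) <= eps by lra.
have := rate_distortion_le_code mu eps0 r_ge0 r_le eq mq.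
move=> /le_trans; apply; rewrite lee_fin abs_ln_lt1//.
have e12 : eps / 4 / 3 = eps / 12 by field.
move: lnM; rewrite e12 ln_div ?posrE//; lra.
Unshelve. all: by end_near. Qed.

End ShiftDimensions.

Lemma integral_finite_fibers d (T : measurableType d) (R : realType)
    (P : probability T R) (K : finType) (a : T -> K) (F : K -> R) :
    (forall k, measurable (a @^-1` [set k])) -> (forall k, 0 <= F k) ->
  (\int[P]_x (F (a x))%:E = (\sum_k F k * fine (P (a @^-1` [set k])))%:E)%E.
Proof.
move=> ma F0.
have -> : (fun x => (F (a x))%:E) =
    (fun x => \sum_k (F k * \1_(a @^-1` [set k]) x)%:E)%E.
  apply/funext => x; rewrite (bigD1 (a x))//= big1 ?adde0; last first.
    by move=> k ka; rewrite indicE memNset ?mulr0//= => ax; rewrite ax eqxx in ka.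
  by rewrite indicE mem_set ?mulr1.
have mind k : measurable_fun setT (EFin \o (\1_(a @^-1` [set k]) : T -> R)).
  by apply/measurable_EFinP; exact: measurable_indic.
under eq_integral do under eq_bigr do rewrite EFinM.
rewrite ge0_integral_sum//; last 2 first.
- by move=> k; apply: measurable_funeM; exact: mind.
- by move=> k x _; rewrite mule_ge0// lee_fin.
rewrite -sumEFin; apply: eq_bigr => k _.
rewrite ge0_integralZl_EFin//; last exact: mind.
by rewrite integral_indic// setIT EFinM fineK// fin_num_measure.
Qed.

Lemma ln_prod (R : realType) (I : finType) (f : I -> R) : (forall i, 0 < f i) ->
  ln (\prod_i f i) = \sum_i ln (f i).
Proof.
move=> f0; suff [] : 0 < \prod_i f i /\ ln (\prod_i f i) = \sum_i ln (f i) by [].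
elim/big_ind2 : _ => [|x u y v [x0 <-] [y0 <-]|i _]; rewrite ?ln1//.
by rewrite mulr_gt0// lnM ?posrE.
Qed.

(** * Lower bound for the rate of a measure dominated by products *)

Section RateDistortionLower.
Context {R : realType} {X : compactMetricType R}.
Local Notation shift := (left_shift X).
Variables (rho : probability (borel X) R) (s c r0 : R).
Hypothesis rho_growth : ball_growth rho s c r0.

(** The law of the first [n] coordinates is at most [C ^ n] times the product of [rho], tested on
    boxes only; each cell of a block code is a box. *)
Definition product_dominated (C : R) (mu : probability (borel (seqspace X)) R) :=
  forall (n : nat) (A : nat -> set X),
    (forall i, measurable (A i : set (borel X))) ->
  fine (mu [set x : seqspace X | forall i, (i < n)%N -> A i (x i)]) <=
    C ^+ n * \prod_(i < n) fine (rho (A i)).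

Variables (mu : probability (borel (seqspace X)) R) (C : R).
Hypothesis C_ge1 : 1 <= C.
Hypothesis mu_dominated : product_dominated C mu.

Section Scale.
Variables (eps L : R).
Hypotheses (eps_gt0 : 0 < eps) (eps_lt1 : eps < 1) (L_ge1 : 1 <= L).
Hypothesis eps_small : (L + 3) * eps <= r0.
Variables (m : nat) (e : 'I_m -> X) (q : X -> 'I_m).
Hypothesis q_near : forall x, mdist (e (q x)) x <= eps.
Hypothesis mq : forall i, measurable (q @^-1` [set i] : set (borel X)).

(** Closeness is a relation between cells rather than points, so that the test function takes
    finitely many values and is constant on pairs of cells. *)
Let close (i j : 'I_m) : bool :=
  `[< exists x z, [/\ q x = i, q z = j & mdist x z < L * eps] >].

(* [expR (- (s * ln eps))] is [eps ^ - s], the inverse order of the mass of a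
   ball of radius [eps]. *)
Let weight (i j : 'I_m) : R := if close i j then expR (- (s * ln eps)) else 1.

Let weight_gt0 i j : 0 < weight i j.
Proof. by rewrite /weight; case: ifP => // _; exact: expR_gt0. Qed.

Let bound : R := 1 + c * (L + 3) `^ s.

(** All cells close to [j] lie in the ball of radius [(L + 3) * eps] about [e j]: going from [e j]
    to a point of such a cell costs [L * eps] once and [eps] three times. The factor [eps ^ s] in
    the mass of this ball cancels the weight [eps ^ - s]; the other cells have weight 1. *)
Let sum_weight_le (j : 'I_m) :
  \sum_i fine (rho (q @^-1` [set i])) * weight i j <= bound.
Proof.
move: rho_growth => [s0 c1 r00 rg].
have L3 : 0 < (L + 3) * eps by rewrite mulr_gt0//; move: L_ge1; lra.
apply: (@le_trans _ _ (\sum_i fine (rho (q @^-1` [set i])) +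
    expR (- (s * ln eps)) * \sum_(i | close i j) fine (rho (q @^-1` [set i])))).
  rewrite mulr_sumr [X in _ <= _ + X]big_mkcond -big_split /=; apply: ler_sum => i _.
  rewrite /weight; case: ifP => _; last by rewrite mulr1 addr0.
  by rewrite mulrC lerDr fine_probability_ge0.
rewrite (sum_fibers rho mq) lerD2l -(fine_measure_bigcup rho _ mq); last first.
  exact: trivIset_preimage.
have -> : c * (L + 3) `^ s =
    expR (- (s * ln eps)) * (c * ((L + 3) * eps) `^ s).
  rewrite powRM ?(ltW eps_gt0)//; last by move: L_ge1; lra.
  rewrite [eps `^ s]/powR gt_eqF// expRN; field.
  by rewrite gt_eqF ?expR_gt0.
rewrite ler_pM2l ?expR_gt0//.
have mU : measurable (\bigcup_(i in [set i | close i j]) q @^-1` [set i]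
    : set (borel X)).
  by apply: fin_bigcup_measurable => // i _; exact: mq.
rewrite -lee_fin fineK ?fin_num_measure//.
have [_] := rg (e j) _ L3 eps_small; apply: le_trans.
apply: le_measure; rewrite ?inE//; first exact: cball_measurable.
move=> x [i /= /asboolP[x' [z [qx' qz x'z]]] qx]; rewrite /cball /=.
have := metric_triangle (e j) z x; have := metric_triangle z x' x.
have := metric_triangle x' (e i) x; rewrite (metric_sym z x') (metric_sym x' (e i)).
have := q_near x; have := q_near x'; have := q_near z; rewrite qx' qz qx; lra.
Qed.

Section Test.
Variables (n : nat) (d : measure_display) (Om : measurableType d)
  (P : probability Om R) (X0 : {RV P >-> borel (seqspace X)})
  (Z : {RV P >-> n.-tuple (borel (seqspace X))}).
Hypothesis n_gt0 : (0 < n)%N.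
Hypothesis X0_law :
  forall A : set (borel (seqspace X)), measurable A -> distribution P X0 A = mu A.
Hypothesis distortion : ('E_P[(fun w => n%:R^-1 *
   \sum_(k < n) mdist (iter k shift (X0 w) : seqspace X) (tnth (Z w) k : seqspace X))%R]
          < eps%:E)%E.

Let code1 : borel (seqspace X) -> {ffun 'I_n -> 'I_m} := block_code n q.

Let code2 (y : n.-tuple (borel (seqspace X))) : {ffun 'I_n -> 'I_m} :=
  [ffun k => q ((tnth y k : seqspace X) 0%N)].

Let mcode1 i : measurable (code1 @^-1` [set i]).
Proof. exact: measurable_block_code. Qed.

Let mcode2 j : measurable (code2 @^-1` [set j]).
Proof.
have -> : code2 @^-1` [set j] = \bigcap_(k in [set: 'I_n])
    ((fun x : seqspace X => x 0%N) \o (fun y => tnth y k)) @^-1` (q @^-1` [set j k]).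
  apply/seteqP; split=> [y /= <- k _ /=|y yj]; first by rewrite ffunE.
  by apply/ffunP => k; rewrite ffunE; exact: yj.
apply: fin_bigcap_measurable; first exact: finite_finset.
move=> k _; have := measurableT_comp (@measurable_coord R X 0)
  (@measurable_tnth _ (borel (seqspace X)) n k).
by move=> /(_ measurableT _ (mq (j k))); rewrite setTI.
Qed.

Let a := code1 \o X0.
Let b := code2 \o Z.

Let ma i : measurable (a @^-1` [set i]).
Proof. by have := measurable_funPTI X0 (mcode1 i). Qed.

Let mb j : measurable (b @^-1` [set j]).
Proof. by have := measurable_funPTI Z (mcode2 j). Qed.

Let total_weight (i j : {ffun 'I_n -> 'I_m}) := \prod_k weight (i k) (j k).

Let total_weight_gt0 i j : 0 < total_weight i j.
Proof. by apply: prodr_gt0 => k _; exact: weight_gt0. Qed.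

Let mass_block_le (i : {ffun 'I_n -> 'I_m}) :
  fine (P (a @^-1` [set i])) <=
    C ^+ n * \prod_k fine (rho (q @^-1` [set i k])).
Proof.
pose A k := oapp (fun k' : 'I_n => q @^-1` [set i k']) setT (insub k).
have mA k : measurable (A k : set (borel X)).
  by rewrite /A; case: insub => [k'|] /=; [exact: mq|exact: measurableT].
have -> : P (a @^-1` [set i]) = mu (code1 @^-1` [set i]) by rewrite -X0_law.
have -> : code1 @^-1` [set i] =
    [set x : seqspace X | forall k, (k < n)%N -> A k (x k)].
  apply/seteqP; split=> [x /= xi k kn|x xi].
    by rewrite /A insubT /= -xi ffunE.
  apply/ffunP => k; rewrite ffunE; have := xi k (ltn_ord k).
  by rewrite /A valK.
apply: le_trans (mu_dominated n mA) _; rewrite le_eqVlt; apply/orP; left.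
by apply/eqP; congr (_ * _); apply: eq_bigr => k _; rewrite /A valK.
Qed.

(** For each fixed [j] the domination of the law of [a] turns the sum over words [i] into a product
    over coordinates ([bigA_distr_bigA]), with each factor at most [C * bound]. Averaging over the
    law of [b] keeps the bound. *)
Let sum_total_weight_le :
  \sum_j \sum_i fine (P (a @^-1` [set i])) * fine (P (b @^-1` [set j]))
    * total_weight i j <= (C * bound) ^+ n.
Proof.
have C0 : 0 <= C := le_trans ler01 C_ge1.
rewrite -[leRHS]mul1r -(sum_fibers P mb) mulr_suml; apply: ler_sum => j _.
under eq_bigr do rewrite mulrAC mulrC.
rewrite -mulr_sumr ler_wpM2l ?fine_probability_ge0//.
apply: (@le_trans _ _ (\sum_(i : {ffun 'I_n -> 'I_m})
    \prod_k (C * (fine (rho (q @^-1` [set i k])) * weight (i k) (j k))))).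
  apply: ler_sum => i _; rewrite big_split /= prodr_const card_ord big_split mulrA.
  by rewrite ler_wpM2r ?mass_block_le// ltW.
rewrite -(bigA_distr_bigA
  (fun k l => C * (fine (rho (q @^-1` [set l])) * weight l (j k)))).
rewrite -[n in _ ^+ n]card_ord -prodr_const; apply: ler_prod => k _.
rewrite -mulr_sumr ler_wpM2l ?sum_weight_le// andbT mulr_ge0// sumr_ge0// => l _.
by rewrite mulr_ge0 ?fine_probability_ge0// ltW.
Qed.

Let far (i j : {ffun 'I_n -> 'I_m}) : R := \sum_k (~~ close (i k) (j k))%:R.

Let far_dist_le w : L * eps * far (a w) (b w) <=
  \sum_(k < n) mdist (iter k shift (X0 w) : seqspace X) (tnth (Z w) k : seqspace X).
Proof.
rewrite mulr_sumr; apply: ler_sum => k _.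
case: (boolP (close _ _)) => [_|/asboolPn nclose] /=.
  by rewrite mulr0 mdist_ge0.
rewrite mulr1; apply: le_trans (coord0_dist_le _ _).
rewrite leNgt; apply/negP => d_lt; apply: nclose.
exists (iter k shift (X0 w) 0%N), ((tnth (Z w) k : seqspace X) 0%N); split => //.
  by rewrite iter_left_shift addn0 /a /= /code1 /block_code ffunE.
by rewrite /b /= /code2 ffunE.
Qed.

(* Markov's inequality for the proportion of coordinates with distortion at
   least [L * eps]. *)
Let mean_far_le :
  \sum_j \sum_i joint_mass P a b i j * far i j <= n%:R / L.
Proof.
have L0 : 0 < L := lt_le_trans ltr01 L_ge1.
have n0 : (0 : R) < n%:R by rewrite ltr0n.
have mab ij : measurable ((fun w => (a w, b w)) @^-1` [set ij]).
  have -> : (fun w => (a w, b w)) @^-1` [set ij] =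
      a @^-1` [set ij.1] `&` b @^-1` [set ij.2].
    by case: ij => i j; apply/seteqP; split=> [w [<- <-]//|w [/= -> ->]].
  exact: measurableI.
pose F (ij : {ffun 'I_n -> 'I_m} * {ffun 'I_n -> 'I_m}) :=
  n%:R^-1 * (L * eps * far ij.1 ij.2).
have F0 ij : 0 <= F ij.
  by rewrite /F !mulr_ge0 ?invr_ge0 ?(ltW L0) ?(ltW eps_gt0)// sumr_ge0.
have /le_lt_trans/(_ distortion) :
    (\int[P]_w (F (a w, b w))%:E <= 'E_P[(fun w => n%:R^-1 *
      \sum_(k < n) mdist (iter k shift (X0 w) : seqspace X)
        (tnth (Z w) k : seqspace X))%R])%E.
  rewrite unlock; apply: ge0_le_integral_nonmeasurable => w _; rewrite lee_fin//.
  by rewrite ler_pM2l ?invr_gt0// far_dist_le.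
rewrite (integral_finite_fibers P mab F0) lte_fin => /ltW.
have -> : \sum_ij F ij * fine (P ((fun w => (a w, b w)) @^-1` [set ij])) =
    n%:R^-1 * (L * eps) * \sum_j \sum_i joint_mass P a b i j * far i j.
  rewrite exchange_big pair_big mulr_sumr; apply: eq_bigr => -[i j] _ /=.
  rewrite /F /joint_mass /=.
  have -> : (fun w => (a w, b w)) @^-1` [set (i, j)] =
      a @^-1` [set i] `&` b @^-1` [set j].
    by apply/seteqP; split=> [w [<- <-]//|w [/= -> ->]].
  by ring.
rewrite -ler_pdivlMl ?mulr_gt0 ?invr_gt0// => /le_trans; apply.
rewrite le_eqVlt; apply/orP; left; apply/eqP.
by field; rewrite !gt_eqF.
Qed.

Lemma mutual_information_dominated_ge :
  ((n%:R * ((1 - L^-1) * s * `|ln eps| - ln (C * bound)))%:E <=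
    mutual_information X0 Z)%E.
Proof.
move: (rho_growth) => [s0 c1 r00 _].
have bound0 : 0 < bound.
  by rewrite ltr_wpDr// mulr_ge0 ?powR_ge0// (le_trans ler01).
have CB0 : 0 < C * bound by rewrite mulr_gt0// (lt_le_trans ltr01).
have ln_eps : ln eps <= 0 by rewrite ln_le0// ltW.
apply: le_trans _ (mutual_information_ge X0 Z mcode1 mcode2); rewrite lee_fin.
apply: le_trans _ (partition_information_ge ma mb _ total_weight_gt0
  sum_total_weight_le); last by rewrite exprn_gt0.
rewrite lnXn// abs_ln_lt1// -[ln _ *+ n]mulr_natl mulrBr lerD2r.
(* The logarithm of the test function is [s * |ln eps|] times the number of close coordinates, so
   its mean is controlled by [mean_far_le]. *)
have lnw i j : ln (weight i j) = - (s * ln eps) * (1 - (~~ close i j)%:R).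
  by rewrite /weight; case: (close i j); rewrite ?expRK ?ln1 /=; ring.
have lnt i j : ln (total_weight i j) = - (s * ln eps) * (n%:R - far i j).
  rewrite ln_prod//; under eq_bigr do rewrite lnw.
  rewrite -mulr_sumr; congr (_ * _).
  by rewrite sumrB sumr_const card_ord.
have -> : \sum_j \sum_i joint_mass P a b i j * ln (total_weight i j) =
    - (s * ln eps) * (n%:R - \sum_j \sum_i joint_mass P a b i j * far i j).
  rewrite -[X in _ * (X - _)]mul1r -[X in X * n%:R](sum_joint_mass P ma mb).
  rewrite mulr_suml -sumrB mulr_sumr.
  apply: eq_bigr => j _; rewrite mulr_suml -sumrB mulr_sumr.
  by apply: eq_bigr => i _; rewrite lnt; ring.
have -> : n%:R * ((1 - L^-1) * s * - ln eps) =
    - (s * ln eps) * (n%:R - n%:R / L) by ring.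
rewrite ler_wpM2l// ?lerD2l ?lerN2 ?mean_far_le//.
by rewrite -mulrN mulr_ge0// oppr_ge0.
Qed.

End Test.

Lemma rate_distortion_dominated_ge :
  (((1 - L^-1) * s * `|ln eps| - ln (C * bound))%:E <=
    rate_distortion shift mu eps)%E.
Proof.
apply: le_ereal_inf_tmp => _ [n [d [Om [P [X0 [Z [n0 law dist ->]]]]]]].
have nR : (0 : R) < n%:R by rewrite ltr0n.
have := mutual_information_dominated_ge n0 law dist.
move=> /(lee_wpmul2r (_ : (0 <= (n%:R^-1)%:E)%E)) h.
apply: le_trans (h _); last by rewrite lee_fin invr_ge0.
by rewrite -EFinM lee_fin [leRHS]mulrAC divff ?mul1r// gt_eqF.
Qed.

End Scale.

Lemma lower_rdim_dominated_ge : (s%:E <= lower_rdim shift mu)%E.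
Proof.
move: (rho_growth) => [s0 c1 r00 _].
apply/lee_subgt0Pr => d d0.
have [N hN] := exists_inv_mul_le s d0.
(* [L] is large enough that [s / L <= d]. It is fixed before [eps] tends to 0, so the term
   subtracted in the rate bound is constant. *)
pose L : R := N.+1%:R.
have L1 : 1 <= L by rewrite ler1n.
have L3 : 0 < L + 3 by lra.
apply: (@le_trans _ _ ((1 - L^-1) * s)%:E).
  by rewrite -EFinB lee_fin mulrBl mul1r lerD2l lerN2.
apply: (@limf_einf_log_ge _ (rate_distortion shift mu) _
  (ln (C * (1 + c * (L + 3) `^ s)))).
near=> eps.
have eps0 : 0 < eps by near: eps; exact: nbhs_right_gt.
have eps1 : eps < 1 by near: eps; exact: nbhs_right_lt.
have epsL : (L + 3) * eps <= r0.
  rewrite -ler_pdivlMl//; near: eps; apply: nbhs_right_le.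
  by rewrite mulr_gt0// invr_gt0.
have epsr : eps <= r0.
  apply: le_trans epsL; rewrite ler_peMl ?(ltW eps0)//; lra.
have [m [e [q [_ qe mq _ _]]]] := exists_net rho_growth eps0 epsr.
exact: (rate_distortion_dominated_ge eps0 eps1 L1 epsL qe mq).
Unshelve. all: by end_near. Qed.

End RateDistortionLower.

(** * Gibbs measures are dominated by products *)

Section GibbsDominated.
Context {R : realType} {X : compactMetricType R}.

Lemma continuous_upper_bound (f : X -> R) : continuous f ->
  exists M : R, forall x, f x <= M.
Proof.
move=> cf; have : compact (f @` setT).
  by apply: continuous_compact; [exact: continuous_subspaceT|exact: compact_setT].
move=> /compact_bounded[M [_ hM]]; exists (M + 1) => x.
by apply: le_trans (ler_norm _) (hM (M + 1) _ _ _); [rewrite ltrDl|exists x].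
Qed.

Lemma holder_upper_bound (phi : seqspace X -> R) : holder_continuous phi ->
  exists M : R, forall x, phi x <= M.
Proof.
move=> [alpha [C [a0 _ hphi]]]; have [D hD] := mdist_bounded X.
have D0 : 0 <= D by exact: le_trans (mdist_ge0 _ _) (hD point point).
exists (phi point + `|C| * (2 * D) `^ alpha) => x; rewrite -lerBlDl.
apply: le_trans (ler_norm _) (le_trans (hphi _ _) _).
apply: (@le_trans _ _ (`|C| * mdist x point `^ alpha)).
  by rewrite ler_wpM2r ?powR_ge0// ler_norm.
rewrite ler_wpM2l// ge0_ler_powR ?(ltW a0)// ?nnegrE ?mdist_ge0 ?mulr_ge0//.
(* With [r = 0] and [l = 0] the estimate bounds the diameter of the sequence space by [2 * D]. *)
have := @mdist_le_of_coords _ _ D 0 0 x point (lexx 0) hD.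
by rewrite mulr0 add0r expr0 invr1 mul1r; apply.
Qed.

Lemma measurable_cylinder (n : nat) (A : nat -> set X) :
    (forall i, measurable (A i : set (borel X))) ->
  measurable ([set x | forall i, (i < n)%N -> A i (x i)] : set (borel (seqspace X))).
Proof.
move=> mA; rewrite (_ : [set _ | _] = \bigcap_(i in `I_n) (fun x => x i) @^-1` A i).
  apply: fin_bigcap_measurable; first exact: finite_II.
  by move=> i _; have := @measurable_coord R X i measurableT _ (mA i); rewrite setTI.
by apply/seteqP; split.
Qed.

Variable rho : probability (borel X) R.

(** The two bounds go through one induction, since comparing the outer integral requires the inner
    one to be nonnegative. *)
Lemma iterated_integral_le (As : seq (set X)) (f : seq X -> R) (B : R) :
    0 <= B -> (forall l, size l = size As -> 0 <= f l <= B) ->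
    (forall i, measurable (nth setT As i : set (borel X))) ->
  (0 <= iterated_integral rho As f)%E /\
  (iterated_integral rho As f <= (B * \prod_(A <- As) fine (rho A))%:E)%E.
Proof.
move=> B0; elim: As f => [|A As ih] f fB mAs /=.
  by rewrite big_nil mulr1 !lee_fin; have /andP := fB [::] erefl.
have ihx x := ih (fun l => f (x :: l)) (fun l sl => fB (x :: l) (congr1 S sl))
  (fun i => mAs i.+1).
split; first by apply: integral_ge0 => x _; exact: (ihx x).1.
have mA : measurable (A : set (borel X)) := mAs 0%N.
rewrite big_cons mulrCA mulrC EFinM fineK ?fin_num_measure//.
apply: integral_le_cst_measure => //.
- by rewrite mulr_ge0// prodr_ge0// => i _; exact: fine_probability_ge0.
- by move=> x _; exact: (ihx x).1.
- by move=> x _; exact: (ihx x).2.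
Qed.

Lemma path_density_bounds (theta : X -> R) (K : X -> X -> R) (C : R) :
    (forall x, 0 <= theta x <= C) -> (forall x y, 0 <= K x y <= C) ->
  forall l, 0 <= path_density theta K l <= C ^+ size l.
Proof.
move=> hth hK [|x l] /=; first by rewrite ler01 lexx.
have C0 : 0 <= C by have /andP[] := hth x; exact: le_trans.
have /andP[p0 pC] : 0 <= \prod_(k <- pairmap K x l) k <= C ^+ size l.
  elim: l x => [|y l ih] x /=; first by rewrite big_nil ler01 lexx.
  rewrite big_cons exprS; have /andP[k0 kC] := hK x y; have /andP[q0 qC] := ih y.
  by rewrite mulr_ge0//= ler_pM.
have /andP[t0 tC] := hth x.
by rewrite mulr_ge0//= exprS ler_pM.
Qed.

(** Compactness bounds the continuous eigenfunctions and, by positivity, the inverse of [psib];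
    together with the bound on [phi] this gives one constant above both densities. *)
Lemma gibbs_product_dominated (phi : seqspace X -> R)
    (mu : probability (borel (seqspace X)) R) :
    holder_continuous phi -> gibbs_measure phi rho mu ->
  exists2 C : R, 1 <= C & product_dominated rho C mu.
Proof.
move=> hphi [lam [psi [psib [lam0 _ [[[cpsi _ _] psi0 _] [[cpsib _ _] psib0 _]] _
  hmu]]]].
have [Mphi hMphi] := holder_upper_bound hphi.
have [M1 hM1] := continuous_upper_bound cpsi.
have [M2 hM2] := continuous_upper_bound cpsib.
have [|M3 hM3] := @continuous_upper_bound (fun x => (psib x)^-1).
  by move=> x; apply: cvgV; [rewrite gt_eqF|exact: cpsib].
have M10 : 0 <= M1 := le_trans (ltW (psi0 point)) (hM1 point).
have M20 : 0 <= M2 := le_trans (ltW (psib0 point)) (hM2 point).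
have M30 : 0 <= M3.
  by apply: le_trans (hM3 point); rewrite invr_ge0 ltW.
set Z := \int[rho]_(y in setT) (psi y * psib y).
(* Nonnegativity suffices: if [Z] were 0, the quotients by it would be 0 by convention. *)
have Z0 : 0 <= Z by apply: Rintegral_ge0 => y _; rewrite mulr_ge0// ltW.
pose Mth := M1 * M2 / Z; pose MK := expR Mphi * M2 * (M3 / lam).
have Mth0 : 0 <= Mth by rewrite !mulr_ge0// invr_ge0.
have MK0 : 0 <= MK by rewrite !mulr_ge0 ?expR_ge0// invr_ge0 ltW.
pose C := 1 + Mth + MK.
have C1 : 1 <= C by rewrite /C; lra.
have hth x : 0 <= initial_density rho psi psib x <= C.
  rewrite /initial_density -/Z; apply/andP; split.
    by rewrite !mulr_ge0 ?invr_ge0// ltW.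
  apply: (@le_trans _ _ Mth); last by rewrite /C; lra.
  by rewrite ler_wpM2r ?invr_ge0// ler_pM ?hM1 ?hM2// ltW.
have hK x y : 0 <= transition_density phi lam psib x y <= C.
  rewrite /transition_density; apply/andP; split.
    by rewrite !mulr_ge0 ?expR_ge0 ?invr_ge0 ?mulr_ge0// ltW.
  apply: (@le_trans _ _ MK); last by rewrite /C; lra.
  rewrite invfM ler_pM ?mulr_ge0 ?expR_ge0 ?invr_ge0 ?(ltW (psib0 _)) ?(ltW lam0)//.
    by rewrite ler_pM ?expR_ge0 ?(ltW (psib0 _))// ler_expR hMphi.
  by rewrite ler_wpM2r ?invr_ge0 ?(ltW lam0).
(* [markov_law] constrains coordinates up to and including [n], that is [n.+1] of them, so the empty
   box is treated apart. *)
exists C => //; case=> [|n] A mA.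
  rewrite expr0 big_ord0 mulr1 (_ : [set _ | _] = setT) ?probability_setT//.
  by apply/seteqP; split.
have fB l : size l = size (mkseq A n.+1) -> 0 <= path_density
    (initial_density rho psi psib) (transition_density phi lam psib) l <= C ^+ n.+1.
  by rewrite size_mkseq => <-; exact: path_density_bounds.
have mAs i : measurable (nth setT (mkseq A n.+1) i : set (borel X)).
  have [lt_in|ge_in] := ltnP i n.+1; first by rewrite nth_mkseq.
  by rewrite nth_default ?size_mkseq.
have [_] := iterated_integral_le (exprn_ge0 _ (le_trans ler01 C1)) fB mAs.
rewrite -(hmu n A mA) -lee_fin big_map -[iota 0 n.+1]/(index_iota 0 n.+1) big_mkord.
apply: le_trans; rewrite fineK//.
by apply: fin_num_measure; apply: measurable_cylinder.
Qed.

End GibbsDominated.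

(** * From Ahlfors regularity to ball growth *)

Section BallGrowth.
Context {R : realType} {X : compactMetricType R}.

(* A one-point space satisfies the hypothesis vacuously; it has growth exponent
   0 instead of [s]. *)
Lemma ahlfors_regular_ball_growth (s : R) (rho : probability (borel X) R) :
    0 < s -> ahlfors_regular s rho ->
  exists s' c r0 : R, ball_growth rho s' c r0.
Proof.
move=> s0 [c c1 hc].
have [[x [y xy]]|] := pselect (exists x y : X, x <> y).
  exists s, c, (mdist x y); split=> //; first exact: ltW.
    by rewrite mdist_gt0; exact/eqP.
  move=> z r r_gt0 rxy; apply: hc => //.
  apply: (@le_trans _ _ (mdist x y)%:E); first by rewrite lee_fin.
  by apply: ereal_sup_ubound; exists x, y.
move=> /forallNP one; exists 0, 1, 1; split=> // x r r_gt0 _.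
have -> : cball x r = setT.
  apply/seteqP; split=> // y _; rewrite /cball /=.
  have -> : y = x by have /forallNP/(_ y)/contrapT := one x.
  by rewrite mdistxx ltW.
by rewrite probability_setT powRr0 invr1 mulr1 lexx.
Qed.

End BallGrowth.

Theorem corollary1p2 (R : realType) (s : R) (X : compactMetricType R)
    (rho : probability (borel X) R) (phi : seqspace X -> R)
    (mu_phi : probability (borel (seqspace X)) R)
    (s_gt0 : 0 < s)
    (rho_regular : ahlfors_regular s rho)
    (phi_holder : holder_continuous phi)
    (phi_two : depends_on_first_two phi)
    (mu_phi_gibbs : gibbs_measure phi rho mu_phi) :
  exists D : \bar R,
    [/\ is_mdim (left_shift X) D,
        ereal_sup [set upper_rdim (left_shift X) mu
                  | mu in invariant_measure (left_shift X)] = D,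
        ereal_sup [set lower_rdim (left_shift X) mu
                  | mu in invariant_measure (left_shift X)] = D
      & is_rdim (left_shift X) mu_phi D].
Proof.
have [s' [c [r0 growth]]] := ahlfors_regular_ball_growth s_gt0 rho_regular.
have [C C1 mu_dom] := gibbs_product_dominated phi_holder mu_phi_gibbs.
have mu_inv : invariant_measure (left_shift X) mu_phi.
  by case: mu_phi_gibbs => ? [? [? []]].
have upper mu : (upper_rdim (left_shift X) mu <= s'%:E)%E.
  exact: shift_upper_rdim_le growth mu.
have lower_upper mu : (lower_rdim (left_shift X) mu <= upper_rdim (left_shift X) mu)%E.
  exact: limf_einf_le_esup.
have lower_phi := lower_rdim_dominated_ge growth C1 mu_dom.
(* The two rate distortion dimensions of [mu_phi] are squeezed to [s']. As [mu_phi] is invariant, it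
   then attains both suprema, which the upper bound for arbitrary measures keeps at [s']. *)
have upper_phiE : upper_rdim (left_shift X) mu_phi = s'%:E.
  by apply/eqP; rewrite eq_le upper (le_trans lower_phi).
have lower_phiE : lower_rdim (left_shift X) mu_phi = s'%:E.
  by apply/eqP; rewrite eq_le lower_phi andbT (le_trans (lower_upper _)).
have mdim_le := shift_upper_mdim_le growth.
have mdim_ge := shift_lower_mdim_ge growth.
have mdim_lower_upper : (lower_mdim (left_shift X) <= upper_mdim (left_shift X))%E.
  exact: limf_einf_le_esup.
exists s'%:E; split.
- split; apply/eqP; rewrite eq_le.
    by rewrite mdim_le (le_trans mdim_ge).
  by rewrite mdim_ge (le_trans mdim_lower_upper).
- apply/eqP; rewrite eq_le; apply/andP; split.
    by apply: ge_ereal_sup => _ [mu _ <-].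
  by rewrite -upper_phiE; apply: ereal_sup_ubound; exists mu_phi.
- apply/eqP; rewrite eq_le; apply/andP; split.
    by apply: ge_ereal_sup => _ [mu _ <-]; exact: le_trans (lower_upper mu) _.
  by rewrite -lower_phiE; apply: ereal_sup_ubound; exists mu_phi.
- by split.
Qed.
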